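(* Let $N\ge 1$ be an integer, let $p>1$, let $l_1$ be any positive number (integer or noninteger), let $l_2>l_1$ be a positive noninteger, and let $\Omega\subset\mathbb{R}^N$ be a domain (bounded or unbounded) with smooth boundary (of class $C^{l_2}$). Then there is a constant $C>0$, depending only on the fixed data $N,\Omega,p,l_1,l_2$ and not on $u$, such that for every $u(x)\in C^{l_2}(\overline{\Omega})\cap L_p(\Omega)$, $$|u|^{(l_1)}_{\overline{\Omega}}\le C\left(|u|^{(l_2)}_{\overline{\Omega}}\right)^{\omega}\left(\|u\|_{p,\Omega}\right)^{1-\omega},\qquad \omega=\frac{pl_1+N}{pl_2+N}.$$
   Context: $\|\cdot\|_{p,\Omega}$ denotes the norm of the Lebesgue space $L_p(\Omega)$. Hölder spaces. For an integer $m\ge 0$ put $$|u|^{(m)}_{\overline{\Omega}}=\sum_{|\overline{\beta}|\le m}\max_{\overline{\Omega}}\left|D_x^{\overline{\beta}}u(x)\right|,$$ where $\overline{\beta}=(\beta_1,\dots,\beta_N)$ is a multiindex with $|\overline\beta|=\beta_1+\dots+\beta_N$ (the maximum is understood as a supremum when $\Omega$ is unbounded). This is the meaning of $|u|^{(l_1)}_{\overline{\Omega}}$ when $l_1$ is an integer. For noninteger $l=m+\alpha$, with $m\ge 0$ an integer and $\alpha\in(0,1)$, the space $C^{l}(\overline{\Omega})$ consists of the functions with finite norm $$|u|^{(l)}_{\overline{\Omega}}=|u|^{(m)}_{\overline{\Omega}}+\sum_{|\overline{\beta}|=m}\left\langle D_x^{\overline{\beta}}u\right\rangle^{(\alpha)}_{\overline{\Omega}},\qquad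 \langle w\rangle^{(\alpha)}_{\overline{\Omega}}=\sup_{x,y\in\overline{\Omega},\,x\ne y}\frac{|w(x)-w(y)|}{|x-y|^{\alpha}}.$$
   Formalization: ''Smooth boundary (of class C^{l2})'' is read as: local graphs with one radius and one norm bound for all boundary points (automatic for compact boundary), and of class at least C^1 when l2<1; without these the inequality fails, e.g. for domains thinning at infinity or with Hölder cusps. *)

(* Defs.v *)
From HB Require Import structures.
From mathcomp Require Import all_boot all_order all_algebra.
From mathcomp Require Import all_classical all_reals all_analysis.

Set Implicit Arguments.
Unset Strict Implicit.
Unset Printing Implicit Defensive.
Import Order.TTheory GRing.Theory Num.Theory.
Import numFieldNormedType.Exports.
Local Open Scope classical_set_scope.
Local Open Scope ring_scope.

(* MathComp-Analysis has no Lebesgue measure on R^n. It is built by induction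
   on n as the product of lebesgue_measure and the measure in dimension n-1,
   transported to n.-tuple R, whose library sigma-algebra is the one generated
   by the coordinates. *)
Section LebesgueRn.
Context {R : realType}.
Local Open Scope ereal_scope.
Local Notation mR := (measurableTypeR R).

Definition tcons n (x : mR * n.-tuple mR) : n.+1.-tuple mR :=
  [tuple of x.1 :: x.2].

Lemma measurable_tcons n : measurable_fun [set: mR * n.-tuple mR] (@tcons n).
Proof.
by apply: measurable_cons; [exact: measurable_fst | exact: measurable_snd].
Qed.

Definition tuncons n (t : n.+1.-tuple mR) : mR * n.-tuple mR :=
  (thead t, [tuple of behead t]).

Lemma tunconsK n : cancel (@tuncons n) (@tcons n).
Proof. by move=> t; rewrite [RHS]tuple_eta. Qed.

Lemma tconsK n : cancel (@tcons n) (@tuncons n).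
Proof. by case=> a t; congr pair; exact: val_inj. Qed.

Lemma measurable_tuncons n :
  measurable_fun [set: n.+1.-tuple mR] (@tuncons n).
Proof.
apply/measurable_fun_pairP; split; first exact: measurable_tnth.
exact: measurable_behead.
Qed.

Section step.
Variables (n : nat) (mu : {sigma_finite_measure set (n.-tuple mR) -> \bar R}).

Definition lebesgueS : set (n.+1.-tuple mR) -> \bar R :=
  pushforward ((@lebesgue_measure R) \x mu) (@tcons n).

HB.instance Definition _ := Measure.copy lebesgueS
  (measure_function_pushforward__canonical__measure_function_Measure
     ((@lebesgue_measure R) \x mu) (@measurable_tcons n)).

Let lebesgueS_sigma_finite : sigma_finite setT lebesgueS.
Proof.
have /sigma_finiteP[F [FT ndF Foo]] := sigma_finiteT (@lebesgue_measure R).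
have /sigma_finiteP[G [GT ndG Goo]] := sigma_finiteT mu.
have FGT (x : mR * n.-tuple mR) : exists k, (F k `*` G k) x.
  have : [set: mR] x.1 by []. 
  rewrite FT => -[i _ Fi].
  have : [set: n.-tuple mR] x.2 by [].
  rewrite GT => -[j _ Gj].
  exists (maxn i j); split.
    by move: x.1 Fi; exact/subsetPset/ndF/leq_maxl.
  by move: x.2 Gj; exact/subsetPset/ndG/leq_maxr.
exists (fun k => @tuncons n @^-1` (F k `*` G k)).
  by apply/seteqP; split=> // t _; have [k Fk] := FGT (tuncons t); exists k.
move=> k; have [mF Fk] := Foo k; have [mG Gk] := Goo k; split.
  rewrite -[X in measurable X]setTI.
  by apply: measurable_tuncons => //; exact: measurableX.
rewrite /= /lebesgueS /pushforward -comp_preimage.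
rewrite (_ : _ \o _ = id); last by apply/funext => x /=; rewrite tconsK.
rewrite preimage_id product_measure1E// lte_mul_pinfty// ge0_fin_numE//.
Qed.

HB.instance Definition _ := Measure_isSigmaFinite.Build _ _ _ lebesgueS
  lebesgueS_sigma_finite.
End step.

Fixpoint lebesgueN n : {sigma_finite_measure set (n.-tuple mR) -> \bar R} :=
  match n with
  | 0%N => [the sigma_finite_measure _ _ of \d_([tuple] : 0.-tuple mR)]
  | m.+1 => [the sigma_finite_measure _ _ of lebesgueS (lebesgueN m)]
  end.

Lemma measurable_box n (A : 'I_n -> set mR) :
  (forall i, measurable (A i)) ->
  measurable [set t : n.-tuple mR | forall i, A i (tnth t i)].
Proof.
move=> mA; rewrite (_ : mkset _ =
    \bigcap_(i in [set: 'I_n]) ((@tnth n mR)^~ i @^-1` A i)); last first.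
  by apply/seteqP; split=> t /= H i; [move=> _|]; exact: H.
apply: fin_bigcap_measurable => // i _; rewrite -[X in measurable X]setTI.
by apply: measurable_tnth => //; exact: mA.
Qed.

Lemma lebesgueN_box n (A : 'I_n -> set mR) :
  (forall i, measurable (A i)) ->
  lebesgueN n [set t | forall i, A i (tnth t i)] =
  \prod_(i < n) lebesgue_measure (A i).
Proof.
elim: n A => [|n IH] A mA.
  by rewrite big_ord0 /= diracE mem_set//=; case.
rewrite big_ord_recl -IH// -product_measure1E//; last first.
  exact: (@measurable_box _ (fun i => A (lift ord0 i)) (fun i => mA _)).
rewrite /= /lebesgueS /pushforward; congr (_ _).
apply/seteqP; split=> [[a t] /= H|[a t] /= [Ha Ht] i].
  split; first by have := H ord0.
  by move=> i; have := H (lift ord0 i); rewrite tnthS.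
by case: (unliftP ord0 i) => [j|] ->//; rewrite tnthS.
Qed.

End LebesgueRn.

Section Hoelder.
Context {R : realType} (N : nat).
Implicit Types (l : R) (m : nat) (D : set 'rV[R]_N) (f u : 'rV[R]_N -> R).

(* The norm of the library on 'rV[R]_N is the maximum norm. *)
Definition enorm (x : 'rV[R]_N) : R := Num.sqrt (\sum_i x 0 i ^+ 2).

Definition partials (s : seq 'I_N) f : 'rV[R]_N -> R :=
  foldr (fun i g x => 'D_(delta_mx 0 i) g x) f s.

(* The classical C^m(D-closure), for D open: all iterated partial derivatives
   of order at most m exist in D and extend continuously to closure D.
   The values of u outside closure D are irrelevant. *)
Definition Cm_closure m D u :=
  {within closure D, continuous u} /\
  forall s : seq 'I_N, (size s <= m)%N ->
    (forall i x, (size s < m)%N -> D x ->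
       derivable (partials s u) x (delta_mx 0 i)) /\
    exists g : 'rV[R]_N -> R,
      {within closure D, continuous g} /\ {in D, partials s u =1 g}.

(* Extension by continuity from D to closure D. *)
Definition extend D f (x : 'rV[R]_N) : R := lim (f y @[y --> within D (nbhs x)]).

Definition degree m (b : {ffun 'I_N -> 'I_m.+1}) : nat := (\sum_i b i)%N.

Definition dmulti D m (b : {ffun 'I_N -> 'I_m.+1}) u : 'rV[R]_N -> R :=
  extend D (partials (flatten [seq nseq (b i) i | i <- enum 'I_N]) u).

Local Open Scope ereal_scope.

Definition Cm_norm m D u : \bar R :=
  \sum_(b : {ffun 'I_N -> 'I_m.+1} | (degree b <= m)%N)
    ereal_sup [set `|dmulti D b u x|%:E | x in closure D].

Definition hoelder_seminorm (a : R) D (w : 'rV[R]_N -> R) : \bar R :=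
  ereal_sup [set r | exists x y, [/\ closure D x, closure D y, x != y &
    r = (`|w x - w y| / enorm (x - y) `^ a)%:E]].

Definition hoelder_norm l D u : \bar R :=
  let m := Num.truncn l in
  Cm_norm m D u +
  if l \is a Num.int then 0 else
    \sum_(b : {ffun 'I_N -> 'I_m.+1} | degree b == m)
      hoelder_seminorm (l - m%:R)%R D (dmulti D b u).

Definition hoelder_space l D u :=
  Cm_closure (Num.truncn l) D u /\ hoelder_norm l D u < +oo.

Definition row_of_tuple (t : N.-tuple (measurableTypeR R)) : 'rV[R]_N :=
  \row_i (tnth t i : R).

Definition Lp_norm (p : R) D u : \bar R :=
  Lnorm (lebesgueN N) p%:E (((EFin \o u) \_ D) \o row_of_tuple).

Definition Lp_space (p : R) D u :=
  measurable_fun (row_of_tuple @^-1` D) (u \o row_of_tuple) /\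
  Lp_norm p D u < +oo.

Definition is_domain D := [/\ open D, connected D & D !=set0].

End Hoelder.

Section Boundary.
Context {R : realType} (N : nat).
Implicit Types (l : R) (D : set 'rV[R]_N).

Definition orthonormal_frame (B : 'M[R]_(N.-1, N)) (e : 'rV[R]_N) :=
  [/\ B *m B^T = 1%:M, e *m e^T = 1%:M & B *m e^T = 0].

(* Near each boundary point x0, in Cartesian coordinates
   (z, t) |-> x0 + z *m B + t *: e, the open set D is the part of the ball of
   radius r above the graph of a function phi. The graphs are of class
   C^max(1,l), so that the boundary is at least C^1 also when l < 1.
   The radius r and the bound M are the same for all boundary points. When the
   boundary is compact this is automatic; when it is not, this is what "of class
   C^l" has to mean, as for C^l(D-closure) itself. *)
Definition smooth_boundary l D :=
  let k := Num.max 1 l in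
  exists r M : R, 0 < r /\ forall x0, closure D x0 -> ~ D x0 ->
  exists (B : 'M[R]_(N.-1, N)) (e : 'rV[R]_N) (phi : 'rV[R]_N.-1 -> R),
    [/\ orthonormal_frame B e,
        hoelder_space k [set z | enorm z < r] phi,
        (hoelder_norm k [set z | (enorm z < r)%R] phi <= M%:E)%E &
        forall z t, enorm (z *m B + t *: e) < r ->
          D (x0 + z *m B + t *: e) <-> phi z < t].

End Boundary.

(* Main.v *)
(** Reduce to one scale [h]. From every point [x] of the domain, the smooth
    boundary gives a uniform cone of size [h], and inside it a cube of size
    comparable with [h] that is visible from [x]. In this cube a mixed difference
    of [u] of order [k] and step comparable with [h] equals [h ^ k] times the
    [k]-th derivative at some point, and its base point can be chosen so that all
    the values of [u] involved are at most of order [h ^ (- N / p) * |u|_p], by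
    Chebyshev's inequality. When [|u|_p <= h ^ (l2 + N / p) * A], where
    [A = |u|^(l2)], this bounds some value of the [k]-th derivative in the cube by
    [C * h ^ (l2 - k) * A]. Descending on [k], the bound is carried to [x]: by the
    Hoelder condition for the top order, and by the mean value inequality on a
    segment of the cone for the lower ones. Local quasiconvexity, again from the
    cones, then gives [|u|^(l1) <= C * h ^ (l2 - l1) * A], and one takes
    [h = (|u|_p / A) ^ (1 / (l2 + N / p))], truncated to the size of the cones.
    Throughout, [`|x|] is the maximum norm on row vectors. *)
Require Import Defs.
From mathcomp Require Import all_boot all_order all_algebra.
From mathcomp Require Import all_classical all_reals all_analysis.
From mathcomp Require Import measurable_realfun.
From mathcomp Require Import ring lra.
Import Order.TTheory GRing.Theory Num.Theory.
Import numFieldNormedType.Exports.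
Local Open Scope classical_set_scope.
Local Open Scope ring_scope.

Set Implicit Arguments.
Unset Strict Implicit.
Unset Printing Implicit Defensive.

(** * Real induction and mean values *)

Section RealInduction.
Context {R : realType}.

(** Real induction. [P] holds at points arbitrarily close to the supremum of the set where it holds,
    and the local hypothesis carries it from there to a point beyond the supremum, unless 1 is
    reached first. *)
Lemma unit_interval_ind (P : R -> Prop) :
  P 0 ->
  (forall t : R, 0 <= t <= 1 -> exists2 d : R, 0 < d &
     forall a b : R, 0 <= a -> a <= b -> b <= 1 ->
       `|a - t| < d -> `|b - t| < d -> P a -> P b) ->
  P 1.
Proof.
move=> P0 loc; pose S := [set t : R | 0 <= t <= 1 /\ P t].
have S0 : S 0 by split=> //; rewrite lexx ler01.
have Sub : ubound S 1 by move=> t [/andP[]].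
have supS : has_sup S by split; [exists 0|exists 1].
have s0 : 0 <= sup S by apply: ub_le_sup => //; exists 1.
have s1 : sup S <= 1 by apply: ge_sup => //; exists 0.
have [d d0 locd] := loc _ (introT andP (conj s0 s1)).
have [a [/andP[a0 a1] Pa] ad] := sup_adherent d0 supS.
have as_ : a <= sup S.
  by apply: ub_le_sup; [exists 1|split=> //; rewrite a0 a1].
pose b := Num.min 1 (sup S + d / 2).
have sb : sup S <= b by rewrite le_min s1 lerDl divr_ge0// ltW.
have b1 : b <= 1 by rewrite ge_min lexx.
have bd : b <= sup S + d / 2 by rewrite ge_min lexx orbT.
have Pb : P b.
  apply: (locd a) => //; first exact: le_trans sb.
    by rewrite ltr_distlC; apply/andP; split; lra.
  by rewrite ltr_distlC; apply/andP; split; lra.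
have bs : b <= sup S.
  by apply: ub_le_sup; [exists 1|split=> //; rewrite b1 (le_trans s0)].
suff -> : 1 = b by [].
apply/eqP; rewrite eq_le b1 andbT leNgt; apply/negP => b1'.
by move: bs; rewrite {1}/b ge_min => /orP[|]; lra.
Qed.

End RealInduction.

(** * Coordinates and the maximum norm *)

Section RowVectors.
Context {R : realType} {N : nat}.
Implicit Types (x y : 'rV[R]_N) (r : R).

Lemma coord_le_norm x i : `|x 0 i| <= `|x|.
Proof.
rewrite [leRHS]/Num.norm /= mx_normrE.
by apply: (le_bigmax _ (fun ij : 'I_1 * 'I_N => `|x ij.1 ij.2|) (0, i)).
Qed.

Lemma norm_le_coord x r : 0 <= r -> (forall i, `|x 0 i| <= r) -> `|x| <= r.
Proof.
move=> r0 xr; rewrite [leLHS]/Num.norm /= mx_normrE; apply/bigmax_leP.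
by split=> // -[i j] _ /=; rewrite ord1.
Qed.

Lemma norm_lt_coord x r : 0 < r -> (forall i, `|x 0 i| < r) -> `|x| < r.
Proof.
move=> r0 xr; rewrite [ltLHS]/Num.norm /= mx_normrE; apply/bigmax_ltP.
by split=> // -[i j] _ /=; rewrite ord1.
Qed.

Lemma norm_delta_le (i : 'I_N) : `|delta_mx 0 i : 'rV[R]_N| <= 1.
Proof.
apply: norm_le_coord => // j; rewrite mxE eqxx /=.
by case: (j == i); rewrite ?normr1 ?normr0.
Qed.

Lemma open_norm (D : set 'rV[R]_N) x : open D -> D x ->
  exists2 d, 0 < d & forall y, `|y - x| < d -> D y.
Proof.
move=> oD Dx; have /nbhs_ballP[d /= d0 dD] := open_nbhs_nbhs (conj oD Dx).
exists d => // y yx; apply: dD; rewrite -ball_normE /=.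
by rewrite distrC.
Qed.

End RowVectors.

Section MeanValue.
Context {R : realType} {N : nat}.
Implicit Types (x y v : 'rV[R]_N) (f : 'rV[R]_N -> R).

(** Both difference quotients are the same function of the increment, so no chain rule and no total
    differentiability enter. *)
Lemma line_derivable f x v (t : R) : derivable f (x + t *: v) v ->
  derivable (fun s : R => f (x + s *: v)) t 1 /\
  'D_1 (fun s : R => f (x + s *: v)) t = 'D_v f (x + t *: v).
Proof.
have E : (fun h : R => h^-1 *: (f (x + (h *: (1 : R) + t) *: v) - f (x + t *: v))) =
    (fun h => h^-1 *: (f (h *: v + (x + t *: v)) - f (x + t *: v))).
  apply/funext => h; congr (_ *: (f _ - _)).
  by rewrite [h *: 1]mulr1 scalerDl addrCA.
by move=> df; rewrite /derivable /derive E.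
Qed.

Lemma line_mean_value f x v (s : R) : 0 <= s ->
  (forall t, 0 <= t <= s -> derivable f (x + t *: v) v) ->
  exists2 t, 0 <= t <= s & f (x + s *: v) - f x = s * 'D_v f (x + t *: v).
Proof.
move=> s0 df; pose g (t : R) := f (x + t *: v).
have dg (t : R) : 0 <= t <= s -> is_derive t 1 g ('D_v f (x + t *: v)).
  by move=> /df /line_derivable[dg <-]; exact: DeriveDef.
have [t||t tI dE] := @MVT_segment R g (fun t => 'D_v f (x + t *: v)) 0 s s0.
- by rewrite in_itv /= => /andP[t0 ts]; apply: dg; rewrite !ltW.
- apply: derivable_within_continuous => t; rewrite in_itv /= => ts.
  by have := dg t ts => -[].
exists t; first by move: tI; rewrite in_itv.
by move: dE; rewrite /g scale0r addr0 subr0 mulrC.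
Qed.

End MeanValue.

(** * Mixed differences *)

Section Lipschitz.
Context {R : realType} {N : nat}.
Variables (D : set 'rV[R]_N) (f : 'rV[R]_N -> R) (K : R).
Hypothesis derf : forall i x, D x -> derivable f x (delta_mx 0 i).
Hypothesis leK : forall i x, D x -> `|'D_(delta_mx 0 i) f x| <= K.

Let cube p r := forall y : 'rV[R]_N, `|y - p| < r -> D y.

Lemma coord_lipschitz p (r : R) x (t : R) i : cube p r ->
  `|x - p| < r -> `|x + t *: delta_mx 0 i - p| < r ->
  `|f (x + t *: delta_mx 0 i) - f x| <= K * `|t|.
Proof.
move=> pr; wlog t0 : x t / 0 <= t => [wl xr xtr|xr xtr].
  have [t0|t0] := leP 0 t; first exact: wl.
  have xE : x + t *: delta_mx 0 i + (- t) *: delta_mx 0 i = x.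
    by rewrite -addrA -scalerDl subrr scale0r addr0.
  have := wl (x + t *: delta_mx 0 i) (- t); rewrite xE normrN [`|f x - _|]distrC.
  by apply => //; rewrite oppr_ge0 ltW.
have r0 : 0 < r by exact: le_lt_trans xr.
have Dx (s : R) : 0 <= s <= t -> D (x + s *: delta_mx 0 i).
  move=> /andP[s0 st]; apply: pr; apply: norm_lt_coord => // j.
  have := le_lt_trans (coord_le_norm _ j) xr.
  have := le_lt_trans (coord_le_norm _ j) xtr.
  rewrite !mxE eqxx /=; case: (j == i); rewrite ?mulr1 ?mulr0 ?addr0//.
  by rewrite !ltr_norml => /andP[? ?] /andP[? ?]; apply/andP; split; lra.
have [s st ->] := line_mean_value t0 (fun (s : R) sI => @derf i _ (Dx s sI)).
by rewrite normrM mulrC ler_wpM2r// leK//; exact: Dx.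
Qed.

(** The coordinates of [a] are replaced by those of [b] one at a time. A cube contains all the
    intermediate points, so bounds on the partial derivatives suffice; the factor [N] counts the
    replacements. *)
Lemma cube_lipschitz p (r : R) a b : cube p r ->
  `|a - p| < r -> `|b - p| < r -> `|f b - f a| <= N%:R * K * `|b - a|.
Proof.
move=> pr ar br; have r0 : 0 < r by exact: le_lt_trans ar.
pose c k : 'rV[R]_N := \row_j (if (j < k)%N then b 0 j else a 0 j).
have c0 : c 0%N = a by apply/rowP => j; rewrite mxE.
have cN : c N = b by apply/rowP => j; rewrite mxE ltn_ord.
have cr k : `|c k - p| < r.
  apply: norm_lt_coord => // j.
  have := le_lt_trans (coord_le_norm _ j) ar.
  have := le_lt_trans (coord_le_norm _ j) br.
  by rewrite !mxE; case: ifP.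
have cS (i : 'I_N) : c i.+1 = c i + (b 0 i - a 0 i) *: delta_mx 0 i.
  apply/rowP => j; rewrite !mxE eqxx /= ltnS leq_eqVlt.
  have [->|ji] := eqVneq j i; first by rewrite eqxx ltnn /= mulr1 addrC subrK.
  by rewrite mulr0 addr0 (negbTE (_ : nat_of_ord j != i)).
have -> : f b - f a = \sum_(i < N) (f (c i.+1) - f (c i)).
  by rewrite -(big_mkord xpredT (fun k => f (c k.+1) - f (c k))) telescope_sumr//
    c0 cN.
apply: le_trans (ler_norm_sum _ _ _) _.
have -> : N%:R * K * `|b - a| = \sum_(i < N) K * `|b - a|.
  by rewrite sumr_const card_ord -[RHS]mulr_natl mulrA.
apply: ler_sum => i _; rewrite cS.
have K0 : 0 <= K by rewrite (le_trans _ (leK i (pr _ ar))).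
apply: le_trans (coord_lipschitz pr _ _) _ => //; first by rewrite -cS.
rewrite ler_wpM2l// (le_trans _ (coord_le_norm _ i))//.
by rewrite !mxE.
Qed.

(** Real induction along the segment: [cube_lipschitz] applies near each of its points, and the
    local bounds add up because distances along a line are additive. *)
Lemma segment_lipschitz x y : open D ->
  (forall t : R, 0 <= t <= 1 -> D (x + t *: (y - x))) ->
  `|f y - f x| <= N%:R * K * `|y - x|.
Proof.
move=> oD xyD; pose g (t : R) := x + t *: (y - x).
pose P t := `|f (g t) - f x| <= N%:R * K * (t * `|y - x|).
have g1 : g 1 = y by rewrite /g scale1r addrC subrK.
suff : P 1 by rewrite /P g1 mul1r.
apply: (unit_interval_ind (P := P));
  first by rewrite /P /g scale0r addr0 subrr normr0 mul0r mulr0.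
move=> t t01; have [d d0 dD] := open_norm oD (xyD t t01).
(* The added 1 keeps the denominator positive when [x = y]. *)
have v0 : 0 < `|y - x| + 1 by rewrite ltr_wpDl.
exists (d / (`|y - x| + 1)); first by rewrite divr_gt0.
have gd a : `|a - t| < d / (`|y - x| + 1) -> `|g a - g t| < d.
  rewrite ltr_pdivlMr// => ad; rewrite /g opprD addrACA subrr add0r -scalerBl.
  by rewrite normrZ (le_lt_trans _ ad)// ler_wpM2l// lerDl.
move=> a b a0 ab b1 /gd ad /gd bd Pa; rewrite /P.
have -> : f (g b) - f x = (f (g b) - f (g a)) + (f (g a) - f x).
  by rewrite addrA subrK.
apply: le_trans (ler_normD _ _) _.
have := cube_lipschitz (p := g t) dD ad bd.
have -> : g b - g a = (b - a) *: (y - x).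
  by rewrite /g opprD addrACA subrr add0r -scalerBl.
rewrite normrZ ger0_norm ?subr_ge0// => h.
by apply: le_trans (lerD h Pa) _; rewrite -mulrDr -mulrDl subrK.
Qed.

End Lipschitz.

(** * Finite differences and symmetry of partial derivatives *)

Section Differences.
Context {R : realType} {N : nat}.
Implicit Types (D : set 'rV[R]_N) (f : 'rV[R]_N -> R) (s : seq 'I_N) (h : R).

Definition diff1 h (i : 'I_N) f (x : 'rV[R]_N) := f (x + h *: delta_mx 0 i) - f x.

Definition mixed_diff h s f := foldr (diff1 h) f s.

(** What [Cm_closure] gives at the points of an open [D], without the extension to the boundary.
    Unlike [Cm_closure] it passes directly to partial derivatives. *)
Definition Cm_on m D f := forall s, (size s <= m)%N ->
  (forall i x, (size s < m)%N -> D x ->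
    derivable (partials s f) x (delta_mx 0 i)) /\
  (forall x, D x -> {for x, continuous (partials s f)}).

Lemma Cm_closure_on m D f : open D -> Cm_closure m D f -> Cm_on m D f.
Proof.
move=> oD [_ Cf] s sm; have [df [g [cg fg]]] := Cf s sm; split=> // x Dx.
have cx : closure D x by exact: subset_closure.
move/subspace_continuousP: cg => /(_ x cx) cg.
have nD : nbhs x D by exact: open_nbhs_nbhs.
change (partials s f @ x --> partials s f x).
rewrite (fg x) ?inE//.
have gf : \forall y \near x, g y = partials s f y.
  by apply: filterS nD => y Dy; rewrite fg ?inE.
apply: cvg_trans (near_eq_cvg gf) _.
apply: cvg_trans cg; apply: cvg_app => A /=.
rewrite /within /= => hA; near=> y.
have Dy : D y by near: y.
have : closure D y -> A y by near: y.
by apply; exact: subset_closure.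
Unshelve. all: by end_near.
Qed.

Lemma partials_rcons s i f : partials (rcons s i) f = partials s (partials [:: i]
  f).
Proof. by rewrite /partials foldr_rcons. Qed.

Lemma Cm_on_partial m D f i : Cm_on m.+1 D f -> Cm_on m D (partials [:: i] f).
Proof.
by move=> Cf s sm; rewrite -partials_rcons; have := Cf (rcons s i);
  rewrite size_rcons; exact.
Qed.

Lemma diff1C h i j f : diff1 h i (diff1 h j f) = diff1 h j (diff1 h i f).
Proof.
by apply/funext => x; rewrite /diff1 (addrAC x); ring.
Qed.

(** Difference operators commute by [diff1C], so any entry of the list can be moved to the front. *)
Lemma mixed_diff_perm h s s' f : perm_eq s s' ->
  mixed_diff h s f = mixed_diff h s' f.
Proof.
have move_front s1 s2 i : mixed_diff h (s1 ++ i :: s2) f = diff1 h i (mixed_diff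
  h (s1 ++ s2) f).
  by elim: s1 => //= j s1 ->; rewrite diff1C.
elim: s s' => [|i s IH] s' ss'; first by move: ss';
  rewrite perm_sym => /perm_nilP ->.
have : i \in s' by rewrite -(perm_mem ss') mem_head.
move=> /splitPr s'E; move: s'E ss' => [s1 s2].
rewrite perm_sym -cat1s perm_catCA /= perm_cons perm_sym => /IH ss.
by rewrite move_front -ss.
Qed.

Lemma derive_shift_point f x v w : derivable f (x + w) v ->
  derivable (fun y => f (y + w)) x v /\ 'D_v (fun y => f (y + w)) x = 'D_v f (x +
    w).
Proof.
have E : (fun h : R => h^-1 *: (f (h *: v + x + w) - f (x + w))) =
    (fun h => h^-1 *: (f (h *: v + (x + w)) - f (x + w))).
  by apply/funext => h; rewrite addrA.
by move=> df; rewrite /derivable /derive E.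
Qed.

Lemma step_norm h i (x : 'rV[R]_N) (t : R) k y : 0 <= t <= h ->
  `|y - (x + t *: delta_mx 0 i)| <= k%:R * h -> `|y - x| <= k.+1%:R * h.
Proof.
move=> /andP[t0 th] yx.
have -> : y - x = (y - (x + t *: delta_mx 0 i)) + t *: delta_mx 0 i.
  by rewrite opprD addrA subrK.
apply: le_trans (ler_normD _ _) _; rewrite -[k.+1]addn1 natrD mulrDl mul1r lerD//.
rewrite normrZ ger0_norm// (le_trans _ th)// -[leRHS]mulr1 ler_wpM2l//.
exact: norm_delta_le.
Qed.

Lemma mixed_diff_derive h s f x v : 0 < h ->
  (forall y, `|y - x| <= (size s)%:R * h -> derivable f y v) ->
  derivable (mixed_diff h s f) x v /\
  'D_v (mixed_diff h s f) x = mixed_diff h s ('D_v f) x.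
Proof.
move=> h0; elim: s x => [|i s IH] x df /=.
  by split=> //; apply: df; rewrite subrr normr0 mul0r.
have [] := IH x _.
  by move=> y yx; apply: df; rewrite (le_trans yx)// ler_wpM2r ?ler_nat// ltW.
move=> d0 D0; have [y yx|] := IH (x + h *: delta_mx 0 i) _.
  by apply: df; apply: step_norm yx; rewrite lexx ltW.
move=> /derive_shift_point[d1 D1'] D1.
split; first exact: derivableB.
by rewrite /diff1 deriveB// D1' D1 D0.
Qed.

(* Since the differences commute, the mean value theorem can be applied to the
   innermost one first, which is the one matching [partials]. *)
Lemma mixed_diff_mean_value m D f s h x : 0 < h -> Cm_on m D f ->
  (size s <= m)%N -> (forall y, `|y - x| <= (size s)%:R * h -> D y) ->
  exists2 y, `|y - x| <= (size s)%:R * h &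
    mixed_diff h s f x = h ^+ size s * partials s f y.
Proof.
move=> h0; elim/last_ind: s m f x => [|s i IH] m f x Cf sm xD.
  by exists x; [rewrite subrr normr0 mul0r|rewrite expr0 mul1r].
rewrite size_rcons in sm xD; case: m Cf sm => // m Cf sm.
have Dx (t : R) y : 0 <= t <= h ->
  `|y - (x + t *: delta_mx 0 i)| <= (size s)%:R * h -> D y.
  by move=> t0h yx; apply: xD; exact: step_norm yx.
have [df _] := Cf [::] isT.
have dG (t : R) : 0 <= t <= h ->
    derivable (mixed_diff h s f) (x + t *: delta_mx 0 i) (delta_mx 0 i) /\
    'D_(delta_mx 0 i) (mixed_diff h s f) (x + t *: delta_mx 0 i) =
    mixed_diff h s (partials [:: i] f) (x + t *: delta_mx 0 i).
  by move=> t0h; apply: mixed_diff_derive => // y /Dx /df; exact.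
have -> : mixed_diff h (rcons s i) f = diff1 h i (mixed_diff h s f).
  by rewrite (mixed_diff_perm _ _ (_ : perm_eq _ (i :: s)))// perm_rcons.
have [t t0h Ht] := line_mean_value (ltW h0) (fun t tI => proj1 (dG t tI)).
rewrite /diff1 Ht (proj2 (dG t t0h)).
have [y yx ->] := IH _ _ _ (Cm_on_partial i Cf) sm (fun y => Dx t y t0h).
exists y; first by rewrite size_rcons; exact: step_norm yx.
by rewrite size_rcons exprS mulrA partials_rcons.
Qed.

Lemma continuous_norm f x (e : R) : {for x, continuous f} -> 0 < e ->
  exists2 d : R, 0 < d & forall y, `|y - x| < d -> `|f y - f x| < e.
Proof.
move=> cf e0; have /cvgrPdist_lt/(_ _ e0)/nbhs_ballP[d /= d0 dP] := cf.
exists d => // y yx; rewrite distrC; apply: dP.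
by rewrite -ball_normE /= distrC.
Qed.

(* Both sides are limits of the same difference quotient. *)
Lemma partials_perm m D f s s' x : open D -> Cm_on m D f -> (size s <= m)%N ->
  perm_eq s s' -> D x -> partials s f x = partials s' f x.
Proof.
move=> oD Cf sm ss' Dx; have sz := perm_size ss'.
have [_ cs] := Cf s sm.
have sm' : (size s' <= m)%N by rewrite -sz.
have [_ cs'] := Cf s' sm'.
apply/eqP; rewrite -subr_eq0 -normr_le0; apply/ler_addgt0Pr => e e0.
rewrite add0r; have e2 : 0 < e / 2 by rewrite divr_gt0.
have [d d0 dP] := continuous_norm (cs x Dx) e2.
have [d' d'0 dP'] := continuous_norm (cs' x Dx) e2.
have [r r0 rD] := open_norm oD Dx.
pose k := Num.min (Num.min d d') r; have k0 : 0 < k by rewrite !lt_min d0 d'0.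
(* Both mean value points then lie within [k] of [x]; the [+ 1] covers the empty list. *)
pose h := k / ((size s)%:R + 1).
have h0 : 0 < h by rewrite divr_gt0// ltr_wpDl.
have hk : (size s)%:R * h < k.
  rewrite /h mulrCA gtr_pMr// ltr_pdivrMr ?ltr_wpDl// mul1r ltrDl//.
have hr y : `|y - x| <= (size s)%:R * h -> D y.
  by move=> yx; apply: rD; rewrite (le_lt_trans yx)// (lt_le_trans hk)//
    ge_min lexx orbT.
have [y yx Ey] := mixed_diff_mean_value h0 Cf sm hr.
rewrite sz in sm hr.
have [y' yx' Ey'] := mixed_diff_mean_value h0 Cf sm hr.
rewrite -sz in Ey' yx'.
move: Ey; rewrite (mixed_diff_perm _ _ ss') Ey' => /(mulfI (lt0r_neq0 (exprn_gt0
  _ h0))) E.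
have A : `|partials s f y - partials s f x| < e / 2.
  by apply: dP; rewrite (le_lt_trans yx)// (lt_le_trans hk)// !ge_min lexx.
have B : `|partials s' f y' - partials s' f x| < e / 2.
  by apply: dP'; rewrite (le_lt_trans yx')// (lt_le_trans hk)// !ge_min lexx orbT.
move: A B; rewrite E !ltr_distlC => /andP[A1 A2] /andP[B1 B2].
by rewrite ler_distlC; apply/andP; split; lra.
Qed.

End Differences.

(** * Lebesgue measure of level sets *)

Section Translation.
Context {R : realType}.
Local Notation mR := (measurableTypeR R).
Local Open Scope ereal_scope.

(** The image of Lebesgue measure under a translation agrees with it on half-open intervals, hence
    everywhere by uniqueness. *)
Lemma lebesgue_measure_shift (c : R) (A : set mR) : measurable A ->
  lebesgue_measure ((fun x : mR => (x + c)%R : mR) @^-1` A) = lebesgue_measure A.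
Proof.
have mc : measurable_fun [set: mR] (fun x : mR => (x + c)%R : mR).
  by apply: (@measurable_funD _ mR R setT id (cst c)).
move=> mA; symmetry.
apply: (@lebesgue_measure_unique R
  (measure_function_pushforward__canonical__measure_function_Measure
    (@lebesgue_measure R) mc)) => // X [[a b] _ <-].
rewrite /= /pushforward.
rewrite (_ : _ @^-1` _ = [set` `](a - c)%R, (b - c)%R]]); last first.
  by apply/seteqP; split=> x /=; rewrite !in_itv /= ltrBlDr lerBrDr.
by rewrite !lebesgue_measure_itv /= !lte_fin !EFinB ltrD2r; case: ifP => //;
  rewrite -!EFinB opprB addrA subrK.
Qed.

Definition tshift n (w : 'rV[R]_n) (t : n.-tuple mR) : n.-tuple mR :=
  [tuple (tnth t i + w ord0 i)%R | i < n].

Lemma measurable_tshift n (w : 'rV[R]_n) :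
  measurable_fun [set: n.-tuple mR] (tshift w).
Proof.
apply/measurable_fun_tnthP => i.
rewrite (_ : _ \o _ = fun t : n.-tuple mR => (tnth t i + w ord0 i)%R : mR).
  apply: (@measurable_funD _ _ R setT (fun t : n.-tuple mR => tnth t i : mR) (cst
    (w ord0 i))) => //.
  exact: measurable_tnth.
by apply/funext => t /=; rewrite tnth_mktuple.
Qed.

(** Induction on the dimension: the translated product measure agrees with the original one on
    rectangles, and a product measure is determined there. *)
Lemma lebesgueN_shift n (w : 'rV[R]_n) (A : set (n.-tuple mR)) : measurable A ->
  lebesgueN n (tshift w @^-1` A) = lebesgueN n A.
Proof.
elim: n w A => [|n IH] w A mA.
  have tid (t : 0.-tuple mR) : tshift w t = t by rewrite [LHS]tuple0 [RHS]tuple0.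
  by rewrite (_ : _ @^-1` A = A)//; apply/seteqP; split=> t /=; rewrite tid.
pose c := w ord0 ord0; pose v : 'rV[R]_n := \row_j w ord0 (lift ord0 j).
pose g (x : mR * n.-tuple mR) : mR * n.-tuple mR :=
  ((x.1 + c)%R : mR, tshift v x.2).
have mg : measurable_fun [set: mR * n.-tuple mR] g.
  apply/measurable_fun_pairP; split.
    apply: (@measurable_funD _ _ R setT (fun x : mR * n.-tuple mR => x.1 : mR)
      (cst c)).
      exact: measurable_fst.
    exact: measurable_cst.
  apply: (measurableT_comp (measurable_tshift v)); exact: measurable_snd.
pose X := @tcons R n @^-1` A.
have mX : measurable X by rewrite -[X]setTI; exact: measurable_tcons.
have tg (x : mR * n.-tuple mR) : tshift w (tcons x) = tcons (g x).
  apply: eq_from_tnth => i; rewrite tnth_mktuple.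
  case: (unliftP ord0 i) => [j|] ->; last by [].
  by rewrite !tnthS tnth_mktuple mxE.
rewrite /= /lebesgueS /pushforward.
rewrite (_ : _ @^-1` (_ @^-1` A) = g @^-1` X); last first.
  by apply/seteqP; split=> x /=; rewrite tg.
symmetry; apply: (product_measure_unique (m' :=
  measure_function_pushforward__canonical__measure_function_Measure
   (@lebesgue_measure R \x lebesgueN n) mg)) => // B C mB mC.
rewrite /= /pushforward.
rewrite (_ : g @^-1` _ = ((fun x : mR => (x + c)%R : mR) @^-1` B) `*` (tshift v
  @^-1` C)); last first.
  by apply/seteqP; split=> x /=.
have mBc : measurable ((fun x : mR => (x + c)%R : mR) @^-1` B).
  by rewrite -[_ @^-1` _]setTI; apply: (@measurable_funD _ mR R setT id (cst c)).
have mCv : measurable (tshift v @^-1` C).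
  by rewrite -[_ @^-1` _]setTI; apply: measurable_tshift.
by rewrite product_measure1E//; congr (_ * _);
  [exact: lebesgue_measure_shift|exact: IH].
Qed.

End Translation.

Section LevelSets.
Context {R : realType} {N : nat}.
Local Notation mR := (measurableTypeR R).
Implicit Types (D : set 'rV[R]_N) (u : 'rV[R]_N -> R).

Definition open_box (z : 'rV[R]_N) (r : R) : set (N.-tuple mR) :=
  [set t | forall i, [set` `]z ord0 i - r, z ord0 i + r[] (tnth t i)].

Lemma measurable_open_box z r : measurable (open_box z r).
Proof.
apply: (@measurable_box R N (fun i => [set` `]z ord0 i - r, z ord0 i + r[])).
by move=> i; exact: measurable_itv.
Qed.

Lemma open_boxP z r t : 0 < r -> open_box z r t <-> `|row_of_tuple t - z| < r.
Proof.
move=> r0; split=> [tz|tz i /=].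
  apply: norm_lt_coord => // i; rewrite !mxE.
  by have := tz i; rewrite /= in_itv /= ltr_distl.
rewrite in_itv /= -ltr_distl.
by have := le_lt_trans (coord_le_norm _ i) tz; rewrite !mxE.
Qed.

Lemma lebesgueN_open_box z r : 0 < r ->
  lebesgueN N (open_box z r) = ((2 * r) ^+ N)%:E.
Proof.
move=> r0; rewrite (@lebesgueN_box R N (fun i => [set` `]z ord0 i - r, z ord0 i +
  r[])).
  rewrite (eq_bigr (fun=> (2 * r)%:E)) => [|i _].
    by rewrite prodEFin prodr_const card_ord.
  rewrite lebesgue_measure_itv /= lte_fin ifT; last by lra.
  by rewrite -EFinB; congr (_%:E); ring.
by move=> i; exact: measurable_itv.
Qed.

(** An open set is the union of the countably many boxes with rational centre and radius [1 / k.+1]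
    that it contains, and boxes belong to the coordinate sigma-algebra. *)
Lemma measurable_row_preimage D : open D ->
  measurable (@row_of_tuple R N @^-1` D).
Proof.
move=> oD; pose q (c : 'rV[rat]_N) : 'rV[R]_N := map_mx ratr c.
pose e (k : nat) : R := k.+1%:R^-1.
have e0 k : 0 < e k by rewrite invr_gt0.
pose F (ck : 'rV[rat]_N * nat) : set (N.-tuple mR) :=
  if `[< forall y, `|y - q ck.1| < e ck.2 ->
    D y >] then open_box (q ck.1) (e ck.2) else set0.
have -> : @row_of_tuple R N @^-1` D = \bigcup_ck F ck.
  apply/seteqP; split=> [t /= Dt|t [[c k] _]]; last first.
    rewrite /F; case: asboolP => [cD|_ //] /(open_boxP _ _ (e0 k)).
    exact: cD.
  have [d d0 dD] := open_norm oD Dt.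
  have [k kd] : exists k, e k < d / 2.
    have [k] := @ltr_add_invr R 0 (d / 2) (divr_gt0 d0 (ltr0Sn R 1)).
    by rewrite add0r; exists k.
  have /choice[c cP] (i : 'I_N) : exists c : rat,
      ratr c \in `]row_of_tuple t ord0 i - e k, row_of_tuple t ord0 i + e k[.
    by apply: rat_in_itvoo; rewrite ltrD2l gtrN// e0.
  have ct : `|row_of_tuple t - q (\row_i c i)| < e k.
    apply: norm_lt_coord => // i; have := cP i.
    by rewrite in_itv /= !mxE -ltr_distl distrC.
  exists (\row_i c i, k) => //; rewrite /F /=; case: asboolP => [cD|[]].
    by apply/open_boxP.
  move=> y yc; apply: dD.
  rewrite -(subrK (q (\row_i c i)) y) -addrA (le_lt_trans (ler_normD _ _))//.
  by rewrite (splitr d) ltrD// (lt_trans _ kd)// distrC.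
apply: countable_bigcupT_measurable; first exact: countableP.
by move=> ck; rewrite /F; case: ifP => _ //; exact: measurable_open_box.
Qed.

(** Chebyshev's inequality for [u] extended by zero; since [a > 0], the points outside [D] do not
    enter the level set. *)
Lemma level_set_measure D u (p a : R) : open D -> 1 < p -> 0 < a ->
  Lp_space p D u ->
  let E := [set t | D (row_of_tuple t) /\ a <= `|u (row_of_tuple t)|] in
  measurable E /\
  ((a `^ p)%:E * lebesgueN N E <= Lp_norm p D u `^ p)%E.
Proof.
move=> oD p1 a0 [mu _] E; have p0 : p != 0 by rewrite gt_eqF// (lt_trans _ p1).
pose g := ((EFin \o u) \_ D) \o @row_of_tuple R N.
have mD := measurable_row_preimage oD.
have mg : measurable_fun setT g.
  rewrite (_ : g = (EFin \o (u \o @row_of_tuple R N)) \_ (@row_of_tuple R N @^-1`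
    D)).
    by apply/(measurable_restrictT _ mD)/measurable_EFinP.
  by apply/funext => t; rewrite /g /= !patchE.
have EE : E = [set: N.-tuple mR] `&` [set t | (a%:E <= `|g t|)%E].
  apply/seteqP; split=> t /=.
    by move=> [Dt ut]; split=> //; rewrite /g /= patchE mem_set//= lee_fin.
  move=> [_]; rewrite /g /= patchE; case: ifPn => [/set_mem Dt|_] /=.
    by rewrite lee_fin.
  by rewrite normr0 lee_fin leNgt a0.
split.
  by rewrite EE; apply: emeasurable_fun_c_infty => //; exact: measurableT_comp.
rewrite EE poweR_Lnorm//.
have := @le_integral_comp_abse _ _ R (lebesgueN N) setT measurableT g a (fun x =>
  (x `^ p)%E).
rewrite poweR_EFin; apply => //.
- exact: measurable_poweR.
- by move=> r _; exact: poweR_ge0.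
- move=> x y; rewrite !inE /= !in_itv /= !andbT => x0 y0 xy.
  by apply: gt0_ler_poweR; rewrite ?in_itv /= ?x0 ?y0 ?leey// ltW// (lt_trans _ p1).
Qed.

(** Union bound. If every point of the cube had a bad translate, the cube would be covered by
    [size vs] translates of the level set, each of measure at most [U ^ p / a ^ p], which is too
    little. *)
Lemma small_values D u (p a r U : R) z (vs : seq 'rV[R]_N) :
  open D -> 1 < p -> 0 < a -> 0 < r -> Lp_space p D u -> Lp_norm p D u = U%:E ->
  (forall y v, v \in vs -> `|y - z| < r -> D (y + v)) ->
  (size vs)%:R * U `^ p < a `^ p * (2 * r) ^+ N ->
  exists2 y, `|y - z| < r & forall v, v \in vs -> `|u (y + v)| < a.
Proof.
move=> oD p1 a0 r0 uLp UE vsD; apply: contraPP => H.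
apply/negP; rewrite -leNgt.
have [] := level_set_measure oD p1 a0 uLp.
set E := [set t | _] => mE; rewrite UE poweR_EFin => leE.
pose F k := tshift (nth 0 vs k) @^-1` E.
have mF k : measurable (F k).
  by rewrite -[F k]setTI; exact: measurable_tshift.
have QF : open_box z r `<=` \big[setU/set0]_(k < size vs) F k.
  move=> t /(open_boxP _ _ r0) tz; apply: contrapT => nF; apply: H.
  exists (row_of_tuple t) => // v vvs; rewrite ltNge; apply/negP => av.
  apply: nF; rewrite -bigcup_mkord.
  exists (index v vs); first by rewrite /= index_mem.
  rewrite /F /= nth_index//.
  have tE : row_of_tuple (tshift v t) = row_of_tuple t + v.
    by apply/rowP => i; rewrite !mxE tnth_mktuple.
  by rewrite /E /= tE; split=> //; exact: vsD.
have : (lebesgueN N (open_box z r) <= \sum_(k < size vs) lebesgueN N (F k))%E.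
  exact: (@content_subadditive _ _ _ (lebesgueN N) _ _ _ (fun k _ => mF k)
    (measurable_open_box z r) QF).
rewrite lebesgueN_open_box// => leQ.
have {}leQ : (((2 * r) ^+ N)%:E <= (size vs)%:R%:E * lebesgueN N E)%E.
  apply: le_trans leQ _; rewrite (eq_bigr (fun=> lebesgueN N E)) => [|k _].
    by rewrite sumr_const card_ord mule_natl.
  by rewrite lebesgueN_shift.
have ap : 0 < a `^ p by exact: powR_gt0.
have N0 : 0 <= (size vs)%:R :> R by [].
rewrite -lee_fin !EFinM.
apply: (@le_trans _ _ ((a `^ p)%:E * ((size vs)%:R%:E * lebesgueN N E))%E).
  by rewrite lee_pmul2l.
by rewrite muleCA lee_wpmul2l// lee_fin.
Qed.

End LevelSets.

(** * Extension by continuity and Hoelder norms *)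

Section Extension.
Context {R : realType} {N : nat}.
Implicit Types (D : set 'rV[R]_N) (u : 'rV[R]_N ->
  R) (s : seq 'I_N) (x y : 'rV[R]_N).

Lemma norm_le_enorm x : `|x| <= enorm x.
Proof.
apply: norm_le_coord => [|i]; first exact: sqrtr_ge0.
rewrite -sqrtr_sqr ler_wsqrtr// (bigD1 i)//= lerDl.
by apply: sumr_ge0 => j _; exact: sqr_ge0.
Qed.

Lemma enorm_le_norm x : enorm x <= N%:R * `|x|.
Proof.
have Nx0 : 0 <= N%:R * `|x| by rewrite mulr_ge0.
rewrite -(ger0_norm Nx0) -sqrtr_sqr ler_wsqrtr//.
apply: (@le_trans _ _ (\sum_(i < N) `|x| ^+ 2)).
  apply: ler_sum => i _; rewrite -real_normK ?num_real//.
  by rewrite lerXn2r ?nnegrE// coord_le_norm.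
rewrite sumr_const card_ord -[leLHS]mulr_natl exprMn ler_wpM2r ?sqr_ge0//.
by rewrite -natrX ler_nat; case: (N) => // n; rewrite leq_pmulr.
Qed.

Lemma closure_norm D x : closure D x <->
  forall d : R, 0 < d -> exists2 y, D y & `|y - x| < d.
Proof.
split=> [cx d d0|cx B /nbhs_ballP[d /= d0 dB]].
  have [|y [Dy yB]] := cx (ball x d); first exact: nbhsx_ballx.
  by exists y => //; move: yB; rewrite -ball_normE /= distrC.
have [y Dy yx] := cx d d0; exists y; split=> //; apply: dB.
by rewrite -ball_normE /= distrC.
Qed.

(** The limit in [extend] exists because the continuous extension provided by [Cm_closure] supplies
    it; otherwise [lim] would carry no information. *)
Lemma extend_approx m D u s x (e : R) : Cm_closure m D u -> (size s <= m)%N ->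
  closure D x -> 0 < e -> exists2 d : R, 0 < d & forall y, D y -> `|y - x| < d ->
  `|partials s u y - extend D (partials s u) x| < e.
Proof.
move=> [_ Cu] sm cx e0; have [_ [g [cg ug]]] := Cu s sm.
move/subspace_continuousP: cg => /(_ x cx) cg.
have PF : ProperFilter (within D (nbhs x)) by exact: within_nbhs_proper.
have ug_cvg : partials s u y @[y --> within D (nbhs x)] --> g x.
  have gu : within D (nbhs x) (fun y => g y = partials s u y).
    by rewrite /within /=; apply: nearW => y Dy; rewrite ug ?inE.
  apply: cvg_trans (@near_eq_cvg _ _ (within D (nbhs x)) _ _ _ gu) _;
    apply: cvg_trans cg; apply: cvg_app => A /=.
  move=> hA; change (nbhs x (fun y => D y -> A y)).
  have {}hA : nbhs x (fun y => closure D y -> A y) by exact: hA.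
  by apply: filterS hA => y + Dy; apply; exact: subset_closure.
have -> : extend D (partials s u) x = g x by exact: cvg_lim ug_cvg.
move/cvgrPdist_lt: ug_cvg => /(_ e e0) near_g.
have {near_g} /nbhs_ballP[d /= d0 dP] :
  nbhs x (fun y => D y -> `|g x - partials s u y| < e) by exact: near_g.
exists d => // y Dy yx.
by rewrite distrC; apply: dP => //; rewrite -ball_normE /= distrC.
Qed.

Lemma extend_in m D u s x : Cm_closure m D u -> (size s <= m)%N -> D x ->
  extend D (partials s u) x = partials s u x.
Proof.
move=> Cu sm Dx; apply/eqP; rewrite -subr_eq0 -normr_le0;
  apply/ler_addgt0Pr => e e0.
have cx : closure D x by exact: subset_closure.
have [d d0 dP] := extend_approx Cu sm cx e0.
by rewrite add0r distrC ltW// dP// subrr normr0.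
Qed.

Lemma extend_bound m D u s x (K : R) : Cm_closure m D u -> (size s <= m)%N ->
  (forall y, D y -> `|partials s u y| <= K) -> closure D x ->
  `|extend D (partials s u) x| <= K.
Proof.
move=> Cu sm leK cx; apply/ler_addgt0Pr => e e0.
have [d d0 dP] := extend_approx Cu sm cx e0.
have [y Dy yx] := (closure_norm D x).1 cx d d0.
have := dP y Dy yx; have := leK y Dy.
by rewrite ler_norml ltr_distlC ler_norml => /andP[? ?] /andP[? ?]; apply/andP;
  split; lra.
Qed.

Lemma powR_stretch (t d a : R) : 0 < t -> 0 <= d -> 0 <= a <= 1 ->
  (t * (1 + d)) `^ a <= t `^ a * (1 + d).
Proof.
move=> t0 d0 /andP[a0 a1]; rewrite powRM ?(ltW t0) ?addr_ge0//.
rewrite ler_wpM2l ?powR_ge0//.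
by rewrite (le_trans (ler_powR _ a1)) ?lerDl// powRr1 ?addr_ge0.
Qed.

(** Moving [x] and [y] into [D] by a small fraction of their distance stretches this distance by a
    factor at most [1 + e], and by [powR_stretch] its power [a] by no more. Then [e] tends to 0. *)
Lemma extend_hoelder m D u s (K a : R) x y : Cm_closure m D u -> (size s <= m)%N ->
  0 <= a <= 1 -> 0 <= K ->
  (forall x y, D x -> D y -> x != y ->
    `|partials s u x - partials s u y| <= K * `|x - y| `^ a) ->
  closure D x -> closure D y -> x != y ->
  `|extend D (partials s u) x - extend D (partials s u) y| <= K * `|x - y| `^ a.
Proof.
move=> Cu sm a01 K0 leK cx cy xy; set f := partials s u.
have t0 : 0 < `|x - y| by rewrite normr_gt0 subr_eq0.
set t := `|x - y|; set B := K * t `^ a.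
have B0 : 0 <= B by rewrite mulr_ge0// powR_ge0.
suff H (e : R) : 0 < e -> e < 1 ->
  `|extend D f x - extend D f y| <= B + e * (2 + B).
  (* In the error [e * (2 + B)], the 2 comes from the two approximated values and [B] from the
     stretched distance. *)
  apply/ler_addgt0Pr => e e0; pose e' := Num.min (e / (2 + B)) 2^-1.
  have B2 : 0 < 2 + B by rewrite ltr_wpDr.
  have e'0 : 0 < e' by rewrite lt_min divr_gt0//=.
  apply: le_trans (H e' e'0 _) _; first by rewrite gt_min invf_lt1// ltr1n orbT.
  by rewrite lerD2l -ler_pdivlMr// ge_min lexx.
move=> e0 e1.
have et : 0 < e * t / 2 by rewrite divr_gt0 ?mulr_gt0.
have [d d0 dP] := extend_approx Cu sm cx e0.
have [d' d'0 dP'] := extend_approx Cu sm cy e0.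
have [|x' Dx' xx'] := (closure_norm D x).1 cx (Num.min d (e * t / 2)).
  by rewrite lt_min d0.
have [|y' Dy' yy'] := (closure_norm D y).1 cy (Num.min d' (e * t / 2)).
  by rewrite lt_min d'0.
move: xx' yy'; rewrite !lt_min => /andP[xd xt] /andP[yd yt].
have := dP x' Dx' xd; have := dP' y' Dy' yd; rewrite -/f.
have le1 : `|x' - y'| <= t * (1 + e).
  have -> : x' - y' = (x - y) + ((x' - x) - (y' - y)).
    by apply/rowP => i; rewrite !mxE; ring.
  apply: le_trans (ler_normD _ _) _; rewrite mulrDr mulr1 lerD2l.
  apply: le_trans (ler_normB _ _) _;
    rewrite [leRHS](_ : _ = e * t / 2 + e * t / 2); last by field.
  by rewrite lerD// ltW.
(* Each point moved by less than [e * t / 2] with [e < 1], so they cannot meet. *)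
have xy' : x' != y'.
  apply/eqP => E; have : t <= `|x' - x| + `|y' - y|.
    rewrite (distrC x') /t (_ : x - y = (x - x') + (y' - y)) ?ler_normD//.
    by rewrite E addrA subrK.
  have et1 : e * t < t by rewrite gtr_pMl.
  by move=> tle; lra.
have := leK _ _ Dx' Dy' xy'; rewrite -/f.
have : K * `|x' - y'| `^ a <= B + e * B.
  apply: (@le_trans _ _ (K * (t * (1 + e)) `^ a)).
    by rewrite ler_wpM2l// ge0_ler_powR ?nnegrE ?mulr_ge0 ?addr_ge0 ?(ltW e0)
      ?(ltW t0)//; case/andP: a01.
  rewrite (_ : B + e * B = K * (t `^ a * (1 + e))); last by rewrite /B; ring.
  by rewrite ler_wpM2l// powR_stretch// ltW.
move=> h1; rewrite !ltr_distl !ler_norml => /andP[? ?] /andP[? ?] /andP[? ?].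
by apply/andP; split; lra.
Qed.

End Extension.

(** * Hoelder norms and lists of partial derivatives *)

Section Norms.
Context {R : realType} {N : nat}.
Implicit Types (D : set 'rV[R]_N) (u : 'rV[R]_N ->
  R) (s : seq 'I_N) (x y : 'rV[R]_N).

(** The list through which [dmulti] is defined, so that [dmulti D b u] unfolds to
    [extend D (partials (multi_seq b) u)]. *)
Definition multi_seq m (b : {ffun 'I_N -> 'I_m.+1}) : seq 'I_N :=
  flatten [seq nseq (b i) i | i <- enum 'I_N].

Lemma count_multi_seq m (b : {ffun 'I_N -> 'I_m.+1}) j :
  count_mem j (multi_seq b) = b j.
Proof.
rewrite count_flatten -map_comp sumnE big_map big_enum /= (bigD1 j)//=.
rewrite count_nseq /= eqxx mul1n big1 ?addn0// => i /negbTE ij.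
by rewrite count_nseq /= ij.
Qed.

Lemma size_multi_seq m (b : {ffun 'I_N -> 'I_m.+1}) : size (multi_seq b) = degree b.
Proof.
rewrite size_flatten /shape -map_comp sumnE big_map big_enum /=.
by apply: eq_bigr => i _; rewrite size_nseq.
Qed.

Lemma multi_seq_surj m s : (size s <= m)%N ->
  exists b : {ffun 'I_N -> 'I_m.+1}, perm_eq (multi_seq b) s.
Proof.
move=> sm; exists [ffun i => inord (count_mem i s)].
apply/allP => i _ /=; rewrite count_multi_seq ffunE inordK//.
by rewrite ltnS (leq_trans (count_size _ _)).
Qed.

Lemma sup_extend_ge0 D m (b : {ffun 'I_N -> 'I_m.+1}) u x : D x ->
  (0 <= ereal_sup [set `|dmulti D b u y|%:E | y in closure D])%E.
Proof.
move=> Dx; apply: le_ereal_sup_tmp; exists (`|dmulti D b u x|%:E);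
  last by rewrite lee_fin.
by exists x => //; exact: subset_closure.
Qed.

Lemma Cm_norm_ge0 m D u x : D x -> (0 <= Cm_norm m D u)%E.
Proof. by move=> Dx; apply: sume_ge0 => b _; exact: sup_extend_ge0 Dx. Qed.

(** The norm only contains the ordered lists of multi-indices, hence the rearrangement [s'];
    [partials_perm] removes it where [D] is open. *)
Lemma Cm_norm_ge m D u s x : Cm_closure m D u -> (size s <= m)%N -> D x ->
  exists2 s', perm_eq s' s & ((`|partials s' u x|)%:E <= Cm_norm m D u)%E.
Proof.
move=> Cu sm Dx; have [b bs] := multi_seq_surj sm.
exists (multi_seq b) => //.
have bm : (degree b <= m)%N by rewrite -size_multi_seq (perm_size bs).
rewrite /Cm_norm (bigD1 b)//=.
apply: (@le_trans _ _ (ereal_sup [set `|dmulti D b u x|%:E | x in closure D])).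
  apply: ereal_sup_ubound; exists x; first exact: subset_closure.
  by rewrite /dmulti -/(multi_seq b) (extend_in Cu)// (perm_size bs).
rewrite leeDl//; apply: sume_ge0 => c _.
exact: sup_extend_ge0 Dx.
Qed.

Lemma Cm_norm_le m D u (K : R) : Cm_closure m D u -> 0 <= K ->
  (forall s x, (size s <= m)%N -> D x -> `|partials s u x| <= K) ->
  (Cm_norm m D u <= (#|{ffun 'I_N -> 'I_m.+1}|%:R * K)%:E)%E.
Proof.
move=> Cu K0 leK.
apply: (@le_trans _ _ (\sum_(b : {ffun 'I_N ->
  'I_m.+1} | (degree b <= m)%N) K%:E)%E).
  apply: lee_sum => b bm; apply: ge_ereal_sup => _ [x cx <-]; rewrite lee_fin.
  have sb : (size (multi_seq b) <= m)%N by rewrite size_multi_seq.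
  by apply: (extend_bound Cu sb _ cx) => y; exact: leK.
rewrite sumEFin lee_fin sumr_const mulr_natl ler_wpMn2l//.
exact: max_card.
Qed.

(** A pair of distinct points makes the Hoelder seminorms nonnegative: a supremum over no pairs
    would be [-oo]. *)
Lemma two_points D x (d : R) (i : 'I_N) : 0 < d -> (forall y, `|y - x| < d ->
  D y) ->
  exists x y, [/\ D x, D y & x != y].
Proof.
move=> d0 xD; exists x, (x + (d / 2) *: delta_mx 0 i); split.
- by apply: xD; rewrite subrr normr0.
- apply: xD; rewrite addrAC subrr add0r normrZ ger0_norm ?divr_ge0 ?ltW//.
  by rewrite (le_lt_trans (ler_piMr _ (norm_delta_le i))) ?divr_ge0 ?ltW//; lra.
- rewrite eq_sym -subr_eq0 addrAC subrr add0r; apply/eqP => /rowP /(_ i).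
  by rewrite !mxE !eqxx mulr1 => E; lra.
Qed.

Lemma seminorm_ge0 (a : R) D w x y : D x -> D y -> x != y ->
  (0 <= hoelder_seminorm a D w)%E.
Proof.
move=> Dx Dy xy; apply: le_ereal_sup_tmp.
exists ((`|w x - w y| / enorm (x - y) `^ a)%:E).
  by exists x, y; split=> //; exact: subset_closure.
by rewrite lee_fin divr_ge0// powR_ge0.
Qed.

Lemma Cm_norm_le_hoelder (l : R) D u x y : D x -> D y -> x != y ->
  (Cm_norm (Num.truncn l) D u <= hoelder_norm l D u)%E.
Proof.
move=> Dx Dy xy; rewrite /hoelder_norm leeDl//; case: ifP => // _.
by apply: sume_ge0 => b _; exact: seminorm_ge0 xy.
Qed.

(* The constant [N] comes from comparing the Euclidean and the maximum norm. *)
Lemma hoelder_norm_ge (l A : R) D u s x y : 0 <= l -> l \isn't a Num.int ->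
  Cm_closure (Num.truncn l) D u -> hoelder_norm l D u = A%:E ->
  size s = Num.truncn l -> D x -> D y -> x != y ->
  exists2 s', perm_eq s' s & `|partials s' u x - partials s' u y| <=
    N%:R * A * `|x - y| `^ (l - (Num.truncn l)%:R).
Proof.
move=> l0 lint Cu AE ss Dx Dy xy; set m := Num.truncn l in Cu ss *.
have /andP[a0 a1] : 0 <= l - m%:R <= 1.
  have /andP[ml lm] := truncn_itv l0; rewrite subr_ge0 ml /= lerBlDr.
  by rewrite -natr1 in lm; rewrite addrC ltW.
have [b bs] : exists b : {ffun 'I_N -> 'I_m.+1}, perm_eq (multi_seq b) s.
  by apply: multi_seq_surj; rewrite ss.
have bm : size (multi_seq b) = m by rewrite (perm_size bs).
exists (multi_seq b) => //.
have xy0 : 0 < enorm (x - y).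
  by rewrite (lt_le_trans _ (norm_le_enorm _))// normr_gt0 subr_eq0.
have : ((`|partials (multi_seq b) u x - partials (multi_seq b) u y|
          / enorm (x - y) `^ (l - m%:R))%:E <= A%:E)%E.
  rewrite -AE /hoelder_norm (negbTE lint) -/m addeC.
  rewrite (bigD1 b) /=; last by rewrite -size_multi_seq bm.
  rewrite -addeA; apply: (@le_trans _ _ (hoelder_seminorm (l - m%:R) D (dmulti D
    b u))).
    apply: ereal_sup_ubound; exists x, y; split=> //; try exact: subset_closure.
    by rewrite /dmulti -/(multi_seq b) !(extend_in Cu)// bm.
  rewrite leeDl// adde_ge0//; last exact: Cm_norm_ge0 Dx.
  by apply: sume_ge0 => c _; exact: seminorm_ge0 xy.
rewrite lee_fin ler_pdivrMr ?powR_gt0// => le1; apply: le_trans le1 _.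
have A0 : 0 <= A.
  rewrite -lee_fin -AE (le_trans _ (Cm_norm_le_hoelder _ _ Dx Dy xy))//.
  exact: Cm_norm_ge0 Dx.
rewrite mulrAC mulrC (mulrC _ A) mulrAC (mulrC _ A) -mulrA ler_wpM2l//.
apply: (@le_trans _ _ ((N%:R * `|x - y|) `^ (l - m%:R))).
  by rewrite ge0_ler_powR ?nnegrE ?mulr_ge0 ?enorm_le_norm// ltW.
rewrite powRM// ler_wpM2r ?powR_ge0//.
have N1 : 1 <= N%:R :> R.
  rewrite ler1n lt0n; apply: contra xy => /eqP N0.
  by apply/eqP/rowP => i; have := ltn_ord i; rewrite {2}N0.
by rewrite (le_trans (ler_powR _ a1))// powRr1.
Qed.

(** The bounds pass from [D] to its closure by [extend_bound] and [extend_hoelder]. The maximum norm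
    is at most the Euclidean one, so only the number of multi-indices enters the constant. *)
Lemma hoelder_norm_le (l K H : R) D u : 0 <= l -> Cm_closure (Num.truncn l) D u ->
  0 <= K -> 0 <= H ->
  (forall s x, (size s <= Num.truncn l)%N -> D x -> `|partials s u x| <= K) ->
  (forall s x y, l \isn't a Num.int -> size s = Num.truncn l -> D x -> D y ->
    x != y -> `|partials s u x - partials s u y|
      <= H * `|x - y| `^ (l - (Num.truncn l)%:R)) ->
  (hoelder_norm l D u <= (#|{ffun 'I_N ->
    'I_(Num.truncn l).+1}|%:R * (K + H))%:E)%E.
Proof.
move=> l0 Cu K0 H0 leK leH; set m := Num.truncn l in Cu leK leH *.
have a01 : 0 <= l - m%:R <= 1.
  have /andP[ml lm] := truncn_itv l0; rewrite subr_ge0 ml /= lerBlDr.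
  by rewrite -natr1 in lm; rewrite addrC ltW.
rewrite /hoelder_norm -/m mulrDr EFinD leeD ?Cm_norm_le//.
case: ifPn => [_|lint]; first by rewrite lee_fin mulr_ge0.
apply: (@le_trans _ _ (\sum_(b : {ffun 'I_N -> 'I_m.+1} | degree b == m) H%:E)%E).
  apply: lee_sum => b /eqP bm; apply: ge_ereal_sup => _ [x [y [cx cy xy ->]]].
  have xy0 : 0 < enorm (x - y).
    by rewrite (lt_le_trans _ (norm_le_enorm _))// normr_gt0 subr_eq0.
  rewrite lee_fin ler_pdivrMr ?powR_gt0//.
  have sb : size (multi_seq b) = m by rewrite size_multi_seq.
  have sbm : (size (multi_seq b) <= m)%N by rewrite sb.
  apply: le_trans (extend_hoelder Cu sbm a01 H0 _ cx cy xy) _.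
    by move=> x' y' Dx Dy xy'; exact: leH.
  rewrite ler_wpM2l// ge0_ler_powR ?nnegrE ?(ltW xy0) ?norm_le_enorm//.
  by case/andP: a01.
rewrite sumEFin lee_fin sumr_const mulr_natl ler_wpMn2l//.
exact: max_card.
Qed.

End Norms.

(** * Uniform interior cones *)

Section InteriorCone.
Context {R : realType}.

(** One cube is visible from both points. With [y = x] this is an interior cone condition; for
    distinct close points it joins them by two segments in [D], which is local quasiconvexity. *)
Definition cone_condition {N : nat} (D : set 'rV[R]_N) (h0 c : R) :=
  forall x y (h : R), D x -> D y -> 0 < h -> h <= h0 -> `|x - y| <= c * h ->
  exists z, forall xi, `|xi - z| < c * h -> [/\ `|xi - x| <= h, `|xi - y| <= h,
    (forall t : R, 0 <= t <= 1 -> D (x + t *: (xi - x))) &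
    (forall t : R, 0 <= t <= 1 -> D (y + t *: (xi - y)))].

(** If the segment met no boundary point, real induction would propagate membership in [D] from [x]
    to [w]: near a point outside the closure the implication is vacuous. *)
Lemma segment_exit {N : nat} (D : set 'rV[R]_N) x w : open D -> D x -> ~ D w ->
  exists x0, [/\ closure D x0, ~ D x0 & `|x0 - x| <= `|w - x|].
Proof.
move=> oD Dx Dw; apply: contrapT => nex; apply: Dw.
pose g (t : R) := x + t *: (w - x).
have g1 : g 1 = w by rewrite /g scale1r addrC subrK.
suff : D (g 1) by rewrite g1.
apply: (unit_interval_ind (P := fun t => D (g t)));
  first by rewrite /g scale0r addr0.
move=> t /andP[t0 t1].
have v0 : 0 < `|w - x| + 1 by rewrite ltr_wpDl.
have gd (d a : R) : `|a - t| < d / (`|w - x| + 1) -> `|g a - g t| < d.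
  rewrite ltr_pdivlMr// => ad; rewrite /g opprD addrACA subrr add0r -scalerBl.
  by rewrite normrZ (le_lt_trans _ ad)// ler_wpM2l// lerDl.
have [Dt|nDt] := pselect (D (g t)).
  have [d d0 dD] := open_norm oD Dt.
  exists (d / (`|w - x| + 1)); first by rewrite divr_gt0.
  by move=> a b _ _ _ _ /gd bd _; exact: dD.
have : ~ closure D (g t).
  move=> ct; apply: nex; exists (g t); split=> //.
  by rewrite /g addrAC subrr add0r normrZ ger0_norm// ler_piMl.
move/closure_norm/existsNP => [d /not_implyP[d0 nd]].
exists (d / (`|w - x| + 1)); first by rewrite divr_gt0.
by move=> a b _ _ _ /gd ad _ Da; exfalso; apply: nd; exists (g a).
Qed.

(** Dividing by [N.+1] also makes sense in dimension 0, where the charts of one-dimensional domains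
    live. *)
Lemma enorm_ball_cube {N : nat} (r : R) (z : 'rV[R]_N) :
  0 < r -> `|z| < r / N.+1%:R -> enorm z < r.
Proof.
move=> r0; rewrite ltr_pdivlMr// => zr.
by rewrite (le_lt_trans (enorm_le_norm z))// (le_lt_trans _ zr)//
  mulrC ler_wpM2l// ler_nat.
Qed.

Lemma chart_lipschitz {n : nat} (k r M : R) (phi : 'rV[R]_n -> R) : 1 <= k ->
  0 < r ->
  hoelder_space k [set z | enorm z < r] phi ->
  (hoelder_norm k [set z | (enorm z < r)%R] phi <= M%:E)%E ->
  forall z z', `|z| < r / n.+1%:R -> `|z'| < r / n.+1%:R ->
  `|phi z' - phi z| <= n%:R * `|M| * `|z' - z|.
Proof.
move=> k1 r0 [Cphi _] leM z z' zr zr'; set S := [set z | _] in Cphi leM.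
have m1 : (0 < Num.truncn k)%N by rewrite truncn_gt0.
have [_ /(_ [::] isT) [dphi _]] := Cphi.
pose Q := [set z : 'rV[R]_n | `|z| < r / n.+1%:R].
have QS y : Q y -> S y by exact: enorm_ball_cube.
have rn : 0 < r / n.+1%:R by rewrite divr_gt0.
apply: (@cube_lipschitz _ _ Q phi `|M| _ _ 0 (r / n.+1%:R)); rewrite ?subr0//.
- by move=> i y /QS Sy; exact: dphi.
- move=> i y Qy.
  have [|a [b [Sa Sb ab]]] := @two_points R n S 0 (r / n.+1%:R) i rn.
    by move=> a; rewrite subr0 => /QS.
  have [s' ss] := Cm_norm_ge Cphi (s := [:: i]) m1 (QS y Qy).
  have -> : s' = [:: i] by apply: perm_small_eq.
  move=> /le_trans /(_ (Cm_norm_le_hoelder _ _ Sa Sb ab)) /le_trans /(_ leM).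
  by rewrite lee_fin => h; rewrite (le_trans h)// ler_norm.
- by move=> y; rewrite subr0.
Qed.

(** The square matrix with rows [e] and [B] is orthogonal; its right inverse, the transpose, is also
    a left inverse, and this is the decomposition. *)
Lemma frame_decomp {n : nat} (B : 'M[R]_(n, n.+1)) (e w : 'rV[R]_n.+1) :
  orthonormal_frame (N := n.+1) B e ->
  w = (w *m B^T) *m B + (w *m e^T) 0 0 *: e.
Proof.
move=> [BB ee Be]; pose A : 'M[R]_n.+1 := (col_mx e B : 'M[R]_(1 + n, n.+1)).
have AA : A *m A^T = 1%:M.
  rewrite /A (tr_col_mx e B) (mul_col_row e B e^T B^T) ee BB Be.
  have -> : e *m B^T = 0 by apply: trmx_inj; rewrite trmx_mul trmxK Be trmx0.
  exact: (esym (@scalar_mx_block _ 1 n 1)).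
have := mulmx1C AA; rewrite /A (tr_col_mx e B) (mul_row_col e^T B^T e B) => E.
rewrite -{1}[w]mulmx1 -E mulmxDr !mulmxA addrC; congr (_ + _).
by rewrite {1}[w *m e^T]mx11_scalar mul_scalar_mx.
Qed.

Lemma norm_mulmx_unit {n m : nat} (C : 'M[R]_(n, m)) (w : 'rV[R]_n) :
  (forall i j, `|C i j| <= 1) -> `|w *m C| <= n%:R * `|w|.
Proof.
move=> C1; apply: norm_le_coord => [|j]; first by rewrite mulr_ge0.
rewrite mxE (le_trans (ler_norm_sum _ _ _))//.
have -> : n%:R * `|w| = \sum_(i < n) `|w| by rewrite sumr_const card_ord mulr_natl.
apply: ler_sum => i _; rewrite normrM -[leRHS]mulr1.
by rewrite ler_pM ?C1 ?coord_le_norm.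
Qed.

Lemma unit_rows_le1 {n m : nat} (C : 'M[R]_(n, m)) : C *m C^T = 1%:M ->
  forall i j, `|C i j| <= 1.
Proof.
move=> CC i j; rewrite -(expr_le1 (n := 2))// real_normK ?num_real//.
have CCi : \sum_k C i k * C^T k i = 1.
  by move/matrixP: CC => /(_ i i); rewrite !mxE eqxx.
rewrite -[leRHS]CCi (bigD1 j)//= mxE -expr2 lerDl sumr_ge0// => k _.
by rewrite mxE -expr2 sqr_ge0.
Qed.

(** Far from the boundary, [z = x] works. Otherwise a chart presents [D] as the region above a
    Lipschitz graph, and going up along [e] by [h / 2] leaves room for a cube inside the cone. *)
Lemma interior_cone {n : nat} (l : R) (D : set 'rV[R]_n.+1) :
  open D -> smooth_boundary l D ->
  exists h0 c : R, [/\ 0 < h0, 0 < c, c <= 1 & cone_condition D h0 c].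
Proof.
move=> oD [r [M [r0 chart]]]; pose N : R := n.+1%:R.
have N0 : 0 < N by [].
have N10 : 0 < N + 1 by rewrite addr_gt0.
have N1 : 1 <= N by rewrite ler1n.
(* Offsets smaller than [rho] stay in the chart, and their projections in the cube where [phi] is
   Lipschitz. *)
pose rho := r / (N * (N + 1)).
have NN0 : 0 < N * (N + 1) by rewrite mulr_gt0.
have rho0 : 0 < rho by rewrite divr_gt0.
pose L := n%:R * `|M|; have L0 : 0 <= L by rewrite mulr_ge0.
(* Chosen so that an error of size [2 * (c * h)] added to [(h / 2) *: e] keeps the direction in the
   cone of slope [L]. *)
pose c := (4 * N * (L + 1))^-1.
have c'0 : 0 < 4 * N * (L + 1) by rewrite !mulr_gt0// ltr_wpDl.
have c0 : 0 < c by rewrite invr_gt0.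
have cE : c * N * (L + 1) = 4^-1.
  rewrite /c; field; rewrite !gt_eqF//; first by rewrite ltr_wpDl.
have c4 : c <= 4^-1.
  have NL1 : 1 <= N * (L + 1) by rewrite -[leLHS]mulr1 ler_pM// lerDr.
  by rewrite -cE -mulrA ler_peMr// ltW.
(* Base points will be within [4 * h] of the boundary point and displacements at most [h], so
   everything stays within [5 * h < rho]. *)
exists (rho / 6), c; split=> //; [by rewrite divr_gt0|lra|].
move=> x y h Dx Dy h_gt0 hrho xyh.
have h6 : 6 * h <= rho by lra.
have ch : c * h <= 4^-1 * h by rewrite ler_wpM2r// ltW.
have [xD|] := pselect (forall w, `|w - x| < 3 * h -> D w).
  exists x => xi xix.
  have yx : `|y - x| <= c * h by rewrite distrC.
  have xiy : `|xi - y| <= 2 * (c * h).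
    by rewrite (le_trans (ler_distD x _ _))//; lra.
  split; [lra|lra| |] => t /andP[t0 t1]; apply: xD.
    rewrite addrAC subrr add0r normrZ ger0_norm//.
    by rewrite (le_lt_trans (ler_piMl _ t1))//; lra.
  rewrite addrAC (le_lt_trans (ler_normD _ _))// normrZ (ger0_norm t0).
  by have := ler_piMl (normr_ge0 (xi - y)) t1; lra.
move=> /existsNP[w /not_implyP[wx nDw]].
have [x0 [cx0 nDx0 x0x]] := segment_exit oD Dx nDw.
have [B [e [phi [frame sphi leM chartE]]]] := chart x0 cx0 nDx0.
have k1 : 1 <= Num.max 1 l by rewrite le_max lexx.
have lip := chart_lipschitz k1 r0 sphi leM.
have [BB ee _] := frame.
have e1 := unit_rows_le1 ee; have B1 := unit_rows_le1 BB.
pose zc (a : 'rV[R]_n.+1) : 'rV[R]_n := a *m B^T.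
pose tc (a : 'rV[R]_n.+1) : R := (a *m e^T) 0 0.
have zc_le a : `|zc a| <= N * `|a|.
  by apply: norm_mulmx_unit => i j; rewrite mxE.
have tc_le a : `|tc a| <= N * `|a|.
  apply: le_trans (coord_le_norm _ _) _.
  by apply: norm_mulmx_unit => i j; rewrite mxE.
have DE a : `|a| < rho -> D (x0 + a) <-> phi (zc a) < tc a.
  move=> ar; rewrite {1}(frame_decomp a frame) addrA; apply: chartE.
  rewrite -(frame_decomp a frame) (le_lt_trans (enorm_le_norm _))//.
  rewrite mulrC -ltr_pdivlMr// (lt_le_trans ar)// ler_pM2l//.
  by rewrite lef_pV2 ?posrE// ler_peMr ?lerDr// ltW.
have zc_cube a : `|a| < rho -> `|zc a| < r / n.+1%:R.
  move=> ar; apply: le_lt_trans (zc_le a) _; rewrite mulrC -ltr_pdivlMr//.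
  rewrite (lt_le_trans ar)// /rho -mulrA ler_pM2l//
    -invfM lef_pV2 ?posrE ?mulr_gt0//.
  by rewrite ler_pM2l// lerDl.
have cone p v : D p -> `|p - x0| < rho -> `|p + v - x0| < rho ->
    L * `|zc v| <= tc v -> D (p + v).
  move=> Dp pr pvr Lv.
  have Dp' : phi (zc (p - x0)) < tc (p - x0) by apply/DE => //;
    rewrite [x0 + _]addrC subrK.
  have -> : p + v = x0 + (p + v - x0) by rewrite [x0 + _]addrC subrK.
  apply/DE => //.
  have := lip _ _ (zc_cube _ pr) (zc_cube _ pvr).
  have zE : zc (p + v - x0) = zc (p - x0) + zc v by rewrite /zc -mulmxDl addrAC.
  have tE : tc (p + v - x0) = tc (p - x0) + tc v.
    by rewrite /tc (_ : p + v - x0 = (p - x0) + v) ?mulmxDl ?mxE// addrAC.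
  rewrite zE tE -/L [zc (p - x0) + _ - _]addrAC subrr add0r ler_distl => /andP[_ ?].
  by lra.
have zce : zc e = 0.
  rewrite /zc; have [_ _ Be] := frame.
  by apply: trmx_inj; rewrite trmx_mul trmxK Be trmx0.
have e_le1 : `|e| <= 1 by apply: norm_le_coord.
have seg p q (t : R) : D p -> `|p - x0| <= 4 * h -> `|q| <= 2 * (c * h) ->
  0 <= t <= 1 ->
    D (p + t *: ((h / 2) *: e + q)).
  move=> Dp ph qh /andP[t0 t1].
  have vh : `|(h / 2) *: e + q| <= h.
    rewrite (le_trans (ler_normD _ _))// normrZ ger0_norm;
      last by rewrite divr_ge0 ?ltW.
    have h2 : 0 <= h / 2 by rewrite divr_ge0 ?ltW.
    by have := ler_piMr h2 e_le1; lra.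
  apply: cone => //; first lra.
    rewrite addrAC (le_lt_trans (ler_normD _ _))// normrZ (ger0_norm t0).
    by have := ler_piMl (normr_ge0 ((h / 2) *: e + q)) t1; lra.
  have zE : zc (t *: ((h / 2) *: e + q)) = t *: zc q.
    by rewrite /zc -scalemxAl mulmxDl -scalemxAl -/(zc e) zce scaler0 add0r.
  have tE : tc (t *: ((h / 2) *: e + q)) = t * (h / 2 + tc q).
    by rewrite /tc -scalemxAl mulmxDl -scalemxAl ee 4!mxE eqxx mulr1n mulr1.
  rewrite zE tE normrZ (ger0_norm t0) mulrCA ler_wpM2l//.
  have tq := tc_le q; have zq := ler_wpM2l L0 (zc_le q).
  have tq' := ler_norm (- tc q); rewrite normrN in tq'.
  have : N * `|q| * (L + 1) <= h / 2.
    rewrite (_ : h / 2 = N * (2 * (c * h)) * (L + 1)); last first.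
      have -> : N * (2 * (c * h)) * (L + 1) = 2 * h * (c * N * (L + 1)) by ring.
      by rewrite cE; field.
    by rewrite ler_wpM2r ?addr_ge0// ler_wpM2l// ltW.
  by lra.
(* Seen from [y], the offset [x - y], of size at most [c * h], is absorbed into the error; this is
   why [seg] allows [2 * (c * h)]. *)
exists (x + (h / 2) *: e) => xi xiz.
pose q := xi - (x + (h / 2) *: e).
have xiE : xi - x = (h / 2) *: e + q by rewrite /q; apply/rowP => i;
  rewrite !mxE; ring.
have yE : xi - y = (h / 2) *: e + (q + (x - y)).
  by rewrite /q; apply/rowP => i; rewrite !mxE; ring.
have qh : `|q| <= c * h by rewrite ltW.
have qh2 : `|q + (x - y)| <= 2 * (c * h) by rewrite (le_trans (ler_normD _ _))//;
  lra.
have he : `|(h / 2) *: e| <= h / 2.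
  have h2 : 0 <= h / 2 by rewrite divr_ge0 ?ltW.
  by rewrite normrZ (ger0_norm h2) ler_piMr.
have x0x3 : `|x - x0| <= 3 * h by rewrite distrC (le_trans x0x)// ltW.
have ch0 : 0 < c * h by rewrite mulr_gt0.
split.
- by rewrite xiE (le_trans (ler_normD _ _))//; lra.
- by rewrite yE (le_trans (ler_normD _ _))//; lra.
- by move=> t t01; rewrite xiE; apply: seg => //; lra.
- move=> t t01; rewrite yE; apply: seg => //.
  by rewrite (le_trans (ler_distD x _ _))// (distrC y); lra.
Qed.

End InteriorCone.

(** * Derivative estimate in a cube *)

Section DifferenceBound.
Context {R : realType} {N : nat}.
Implicit Types (f u : 'rV[R]_N -> R) (s : seq 'I_N) (h : R).

(** The offsets, with repetitions, at which [mixed_diff h s] samples its function. *)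
Definition shifts h s : seq 'rV[R]_N :=
  foldr (fun i vs => vs ++ [seq v + h *: delta_mx 0 i | v <- vs]) [:: 0] s.

Lemma size_shifts h s : size (shifts h s) = (2 ^ size s)%N.
Proof. by elim: s => //= i s IH;
  rewrite size_cat size_map IH expnS mul2n addnn. Qed.

Lemma shifts_norm h s v : 0 <= h -> v \in shifts h s -> `|v| <= (size s)%:R * h.
Proof.
move=> h0; elim: s v => [|i s IH] v /=.
  by rewrite inE => /eqP ->; rewrite normr0 mul0r.
have le1 : (size s)%:R * h <= (size s).+1%:R * h by rewrite ler_wpM2r// ler_nat.
rewrite mem_cat => /orP[/IH vh|/mapP[w /IH wh ->]]; first exact: le_trans le1.
rewrite (le_trans (ler_normD _ _))// -natr1 mulrDl mul1r lerD// normrZ ger0_norm//.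
by rewrite ler_piMr// norm_delta_le.
Qed.

Lemma mixed_diff_bound f h s y (a : R) :
  (forall v, v \in shifts h s -> `|f (y + v)| <= a) ->
  `|mixed_diff h s f y| <= 2 ^+ size s * a.
Proof.
elim: s y => [|i s IH] y /= fa.
  by rewrite expr0 mul1r -[y]addr0; apply: fa; rewrite inE.
rewrite /diff1 (le_trans (ler_normB _ _))// exprS -mulrA mulr2n mulrDl mul1r lerD//.
  apply: IH => v vs; rewrite -addrA [_ *: _ + v]addrC; apply: fa.
  by rewrite mem_cat; apply/orP; right; apply/mapP; exists v.
by apply: IH => v vs; apply: fa; rewrite mem_cat vs.
Qed.

Variables (D : set 'rV[R]_N) (m : nat) (p l A U h c : R) (u : 'rV[R]_N -> R).
Hypotheses (oD : open D) (p1 : 1 < p) (A0 : 0 < A) (h0 : 0 < h) (c0 : 0 < c) (c1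
  : c <= 1).
Hypotheses (Cu : Cm_on m D u) (uLp : Lp_space p D u) (UE : Lp_norm p D u = U%:E).
Hypotheses (U0 : 0 <= U) (leU : U <= h `^ (l + N%:R / p) * A).

Definition value_const k : R := 2 ^+ k.+1 / c ^+ N.

(** A [k]-th difference is at most [2 ^ k] times the sampled values; it is divided by the [k]-th
    power of the step [c * h / (2 * k.+1)]. *)
Definition center_const k : R := (4 * k.+1%:R / c) ^+ k * value_const k.

(* The constant makes the bad set of base points, a union of [2 ^ size s]
   translated superlevel sets of [u], smaller than the cube. *)
Lemma small_difference_grid z s :
  (forall y, `|y - z| < c * h -> D y) ->
  exists2 y, `|y - z| < c * h / 2 &
    forall v, v \in shifts (c * h / (2 * (size s).+1%:R)) s ->
      `|u (y + v)| < value_const (size s) * (h `^ l * A).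
Proof.
move=> zD; set k := size s; set d := c * h / (2 * _); set r := c * h / 2.
have p0 : 0 < p by rewrite (lt_trans _ p1).
have ch0 : 0 < c * h by rewrite mulr_gt0.
have r0 : 0 < r by rewrite divr_gt0.
have d0 : 0 < d by rewrite divr_gt0// mulr_gt0.
have cN0 : 0 < c ^+ N by rewrite exprn_gt0.
have E0 : 0 < value_const k by rewrite divr_gt0// exprn_gt0.
have E1 : 1 <= value_const k.
  rewrite ler_pdivlMr// mul1r (@le_trans _ _ 1)//;
    first exact: exprn_ile1 (ltW c0) c1.
  by rewrite exprn_ege1// ler1n.
have hlA : 0 < h `^ l * A by rewrite mulr_gt0// powR_gt0.
have kd : k%:R * d <= r.
  have -> : d = r / k.+1%:R by rewrite /d invfM mulrA.
  rewrite mulrCA ler_piMr ?(ltW r0)//.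
  by rewrite ler_pdivrMr// mul1r ler_nat.
apply: (small_values oD p1 _ r0 uLp UE) => //; first by rewrite mulr_gt0.
  move=> y v vs yz; apply: zD; rewrite addrAC (le_lt_trans (ler_normD _ _))//.
  have := le_trans (shifts_norm (ltW d0) vs) kd.
  by move: yz; rewrite /r; lra.
rewrite size_shifts -/k natrX.
have -> : 2 * r = c * h by rewrite /r; field.
rewrite powRM ?(ltW E0) ?(ltW hlA)// exprMn.
(* The term [N / p] in the exponent of the hypothesis on [U] becomes, after raising to the power
   [p], the volume factor [h ^ N] of the cube. *)
have UU : U `^ p <= (h `^ l * A) `^ p * h ^+ N.
  have -> : (h `^ l * A) `^ p * h ^+ N = (h `^ (l + N%:R / p) * A) `^ p.
    rewrite !powRM ?powR_ge0 ?(ltW A0)// mulrAC; congr (_ * _).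
    rewrite -!powRrM -powR_mulrn ?ltW// -powRD; last by rewrite (gt_eqF h0) implybT.
    by congr (_ `^ _); field; rewrite gt_eqF.
  by rewrite ge0_ler_powR ?nnegrE ?mulr_ge0 ?powR_ge0// ltW.
have EE : 2 ^+ k < value_const k `^ p * c ^+ N.
  apply: (@lt_le_trans _ _ (value_const k * c ^+ N)).
    rewrite /value_const divfK ?gt_eqF// exprS mulr_natl mulr2n ltrDl.
    by rewrite exprn_gt0.
  rewrite ler_wpM2r ?(ltW cN0)//.
  by rewrite -[leLHS]powRr1 ?(ltW E0)// ler_powR// ltW.
have W0 : 0 < (h `^ l * A) `^ p * h ^+ N.
  by rewrite mulr_gt0 ?powR_gt0// exprn_gt0.
apply: le_lt_trans (ler_wpM2l _ UU) _; first by rewrite exprn_ge0.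
rewrite (_ : _ * _ * (c ^+ N * _) =
  value_const k `^ p * c ^+ N * ((h `^ l * A) `^ p * h ^+ N)); last by ring.
by rewrite ltr_pM2r.
Qed.

Lemma center_estimate z s : (size s <= m)%N ->
  (forall y, `|y - z| < c * h -> D y) ->
  exists2 xi, `|xi - z| < c * h &
    `|partials s u xi| <= center_const (size s) * (h `^ (l - (size s)%:R) * A).
Proof.
move=> sm zD; have [y yz] := small_difference_grid s zD.
set d := c * h / (2 * _) => uy.
have ch0 : 0 < c * h by rewrite mulr_gt0.
have d0 : 0 < d by rewrite divr_gt0// mulr_gt0.
have kd : (size s)%:R * d <= c * h / 2.
  have -> : d = c * h / 2 / (size s).+1%:R by rewrite /d invfM mulrA.
  rewrite mulrCA ler_piMr ?divr_ge0 ?(ltW ch0)//.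
  by rewrite ler_pdivrMr// mul1r ler_nat.
have near_z xi : `|xi - y| <= (size s)%:R * d -> `|xi - z| < c * h.
  by move=> xiy; rewrite (le_lt_trans (ler_distD y _ _))//; lra.
have [xi xiy E] := mixed_diff_mean_value d0 Cu sm (fun w wy => zD w (near_z w wy)).
exists xi; first exact: near_z.
have := mixed_diff_bound (fun v vs => ltW (uy v vs)).
rewrite E normrM (ger0_norm (ltW (exprn_gt0 _ d0))) -ler_pdivlMl ?exprn_gt0//.
move=> /le_trans; apply.
rewrite powRB; last by rewrite (gt_eqF h0) implybT.
rewrite powR_mulrn ?(ltW h0)// /center_const; set k := size s.
have k0 : 0 < k.+1%:R :> R by [].
have -> : (d ^+ k)^-1 = (2 * k.+1%:R / c) ^+ k * (h ^+ k)^-1.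
  rewrite -exprVn -exprVn -exprMn; congr (_ ^+ _).
  by rewrite /d; field; rewrite !gt_eqF.
have -> : (4 * k.+1%:R / c) ^+ k = 2 ^+ k * (2 * k.+1%:R / c) ^+ k.
  by rewrite -exprMn; congr (_ ^+ _); field; rewrite gt_eqF.
by rewrite le_eqVlt; apply/orP; left; apply/eqP; ring.
Qed.

Lemma center_const_ge0 k : 0 <= center_const k.
Proof. by rewrite mulr_ge0 ?exprn_ge0 ?divr_ge0 ?exprn_ge0 ?mulr_ge0 ?(ltW c0). Qed.

End DifferenceBound.

(** * Interpolation at a fixed scale *)

Section Interpolation.
Context {R : realType} {N : nat}.
Variables (D : set 'rV[R]_N) (l p h0 c : R).
Local Notation m := (Num.truncn l).
Hypotheses (oD : open D) (l_ge0 : 0 <= l) (lint : l \isn't a Num.int) (p1 : 1 < p).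
Hypotheses (h0_gt0 : 0 < h0) (h0_le1 : h0 <= 1) (c0 : 0 < c) (c1 : c <= 1).
Hypothesis coneD : cone_condition D h0 c.

Implicit Types (u : 'rV[R]_N -> R) (s : seq 'I_N) (x y : 'rV[R]_N) (A U h C : R).

Definition scaled_bound u A h C := forall s x, (size s <= m)%N -> D x ->
  `|partials s u x| <= C * (h `^ (l - (size s)%:R) * A).

Lemma top_hoelder u A s x y : 0 <= A -> Cm_closure m D u ->
  hoelder_norm l D u = A%:E ->
  size s = m -> D x -> D y ->
  `|partials s u x - partials s u y| <= N%:R * A * `|x - y| `^ (l - m%:R).
Proof.
move=> A0 Cu AE sm Dx Dy; have [->|xy] := eqVneq x y.
  by rewrite subrr normr0 mulr_ge0 ?powR_ge0// mulr_ge0.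
have [s' ss] := hoelder_norm_ge l_ge0 lint Cu AE sm Dx Dy xy.
have Cu' := Cm_closure_on oD Cu.
have sm' : (size s' <= m)%N by rewrite (perm_size ss) sm.
by rewrite !(partials_perm oD Cu' sm' ss).
Qed.

Lemma partial_lipschitz u s x y K : Cm_on m D u -> (size s < m)%N ->
  (forall i x, D x -> `|partials (i :: s) u x| <= K) ->
  (forall t : R, 0 <= t <= 1 -> D (x + t *: (y - x))) ->
  `|partials s u y - partials s u x| <= N%:R * K * `|y - x|.
Proof.
move=> Cu sm leK; apply: (@segment_lipschitz _ _ D) => //.
by move=> i z Dz; have [d _] := Cu s (ltnW sm); exact: d.
Qed.

(** Descending induction on the order of the derivative, written as [m - j] so that it becomes an
    induction on [j]. *)
Lemma derivative_bound : exists2 C, 0 <= C & forall u A U h,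
  0 < h -> h <= h0 -> Cm_closure m D u -> hoelder_norm l D u = A%:E -> 0 < A ->
  Lp_space p D u -> Lp_norm p D u = U%:E -> 0 <= U ->
  U <= h `^ (l + N%:R / p) * A -> scaled_bound u A h C.
Proof.
suff H j : exists2 C, 0 <= C & forall u A U h,
  0 < h -> h <= h0 -> Cm_closure m D u -> hoelder_norm l D u = A%:E -> 0 < A ->
  Lp_space p D u -> Lp_norm p D u = U%:E -> 0 <= U ->
  U <= h `^ (l + N%:R / p) * A -> forall s x, (size s <= m)%N ->
    (m - j <= size s)%N ->
  D x -> `|partials s u x| <= C * (h `^ (l - (size s)%:R) * A).
  have [C C0 HC] := H m; exists C => // u A U h ? ? ? ? ? ? ? ? ? s x sm Dx.
  by apply: (HC u A U) => //; rewrite subnn.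
have cc0 k : 0 <= @center_const R N c k by exact: center_const_ge0.
(* The cone condition with [y = x]: the derivative is controlled at some [xi] joined to [x] by a
   segment in [D]. *)
have base u A U h s x : 0 < h -> h <= h0 -> Cm_closure m D u -> 0 < A ->
    Lp_space p D u -> Lp_norm p D u = U%:E -> 0 <= U ->
    U <= h `^ (l + N%:R / p) * A -> (size s <= m)%N -> D x ->
    exists2 xi, `|xi - x| <= h /\ (forall t : R, 0 <= t <= 1 ->
      D (x + t *: (xi - x))) &
      `|partials s u xi| <= @center_const R N c (size s) * (h `^ (l - (size
        s)%:R) * A).
  move=> h_gt0 hh0 Cu A0 uLp UE U0 leU sm Dx.
  have [|z zP] := coneD Dx Dx h_gt0 hh0.
    by rewrite subrr normr0 mulr_ge0// ltW.
  have zD y : `|y - z| < c * h -> D y.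
    by move=> /zP[_ _ /(_ 1) + _]; rewrite scale1r addrC subrK; apply;
      rewrite ler01 lexx.
  have [xi xiz le_xi] := center_estimate oD p1 A0 h_gt0 c0 c1 (Cm_closure_on oD
    Cu) uLp UE U0 leU sm zD.
  by exists xi => //; have [? _ ? _] := zP xi xiz.
elim: j => [|j [C C0 HC]].
  exists (@center_const R N c m + N%:R); first by rewrite addr_ge0.
  move=> u A U h h_gt0 hh0 Cu AE A0 uLp UE U0 leU s x sm; rewrite subn0 => ms Dx.
  have {sm ms}sm : size s = m by apply/eqP; rewrite eqn_leq sm.
  have [|xi [xih xiD] le_xi] := base u A U h s x h_gt0 hh0 Cu A0 uLp UE U0 leU _ Dx.
    by rewrite sm.
  have Dxi : D xi by have := xiD 1; rewrite scale1r addrC subrK; apply;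
    rewrite ler01 lexx.
  have := top_hoelder (ltW A0) Cu AE sm Dx Dxi;
    rewrite (distrC x) sm in le_xi * => le_h.
  have : N%:R * A * `|xi - x| `^ (l - m%:R) <= N%:R * (h `^ (l - m%:R) * A).
    rewrite -mulrA [h `^ _ * A]mulrC; apply: ler_wpM2l => //.
    apply: ler_wpM2l; first exact: ltW.
    apply: ge0_ler_powR; rewrite ?nnegrE ?(ltW h_gt0)//.
    by rewrite subr_ge0; have /andP[] := truncn_itv l_ge0.
  rewrite mulrDl => le_h'.
  have -> : partials s u x = (partials s u x - partials s u xi) + partials s u xi.
    by rewrite subrK.
  by rewrite (le_trans (ler_normD _ _))// addrC lerD// (le_trans le_h).
exists (C + (@center_const R N c (m - j.+1) + N%:R * C)).
  by rewrite !addr_ge0// mulr_ge0.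
move=> u A U h h_gt0 hh0 Cu AE A0 uLp UE U0 leU s x sm ms Dx.
have W0 (b : R) : 0 <= h `^ b * A by rewrite mulr_ge0 ?powR_ge0// ltW.
have [ms'|ms'] := leqP (m - j) (size s).
  apply: le_trans (HC u A U h h_gt0 hh0 Cu AE A0 uLp UE U0 leU s x sm ms' Dx) _.
  by rewrite ler_wpM2r// lerDl addr_ge0// mulr_ge0.
have mj0 : (0 < m - j)%N by exact: leq_ltn_trans ms'.
have sE : (m - j.+1)%N = size s.
  by apply/eqP; rewrite eqn_leq ms subnS -ltnS prednK.
have s_lt : (size s < m)%N by rewrite (leq_trans ms')// leq_subr.
have [xi [xih xiD] le_xi] := base u A U h s x h_gt0 hh0 Cu A0 uLp UE U0 leU sm Dx.
pose K := C * (h `^ (l - (size s).+1%:R) * A).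
have leK i y : D y -> `|partials (i :: s) u y| <= K.
  by move=> Dy; apply: (HC u A U h) => //; rewrite /= -sE subnS prednK.
have K0 : 0 <= K by rewrite mulr_ge0.
have := partial_lipschitz (Cm_closure_on oD Cu) s_lt leK xiD => le_h.
(* The length of the segment, at most [h], compensates for the one more derivative in [K]. *)
have : N%:R * K * `|xi - x| <= N%:R * C * (h `^ (l - (size s)%:R) * A).
  rewrite (_ : N%:R * C * _ = N%:R * K * h).
    by rewrite ler_wpM2l// mulr_ge0.
  rewrite /K -natr1 opprD addrA [in RHS]powRB;
    last by rewrite (gt_eqF h_gt0) implybT.
  by rewrite powRr1 ?(ltW h_gt0)//; field; rewrite gt_eqF.
move=> le_h'; rewrite sE.
have -> : partials s u x = partials s u xi - (partials s u xi - partials s u x).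
  by rewrite opprB addrC subrK.
rewrite (le_trans (ler_normB _ _))// mulrDl ler_wpDl//; first by rewrite mulr_ge0.
by rewrite mulrDl lerD// (le_trans le_h).
Qed.

Hypothesis N0 : (0 < N)%N.

Lemma open_two_points x : D x -> exists x y, [/\ D x, D y & x != y].
Proof.
by move=> Dx; have [d d0 dD] := open_norm oD Dx;
  exact: (two_points (Ordinal N0) d0 dD).
Qed.

Lemma partial_le_hoelder_norm u A s x : Cm_closure m D u ->
  hoelder_norm l D u = A%:E -> (size s <= m)%N -> D x -> `|partials s u x| <= A.
Proof.
move=> Cu AE sm Dx; have [a [b [Da Db ab]]] := open_two_points Dx.
have [s' ss le1] := Cm_norm_ge Cu sm Dx.
have sm' : (size s' <= m)%N by rewrite (perm_size ss).
rewrite -(partials_perm oD (Cm_closure_on oD Cu) sm' ss Dx) -lee_fin -AE.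
exact: le_trans le1 (Cm_norm_le_hoelder _ _ Da Db ab).
Qed.

(** At the fixed scale [h0 <= 1] the powers of [h0] are constants; this serves when the optimal
    scale exceeds the size of the cones. *)
Lemma trivial_bound u A : 0 <= A -> Cm_closure m D u -> hoelder_norm l D u = A%:E ->
  scaled_bound u A h0 (h0 `^ (- l)).
Proof.
move=> A0 Cu AE s x sm Dx.
rewrite (le_trans (partial_le_hoelder_norm Cu AE sm Dx))//.
rewrite mulrA -powRD; last by rewrite (gt_eqF h0_gt0) implybT.
rewrite ler_peMl// -[leLHS](powRr0 h0) ger_powR ?h0_gt0//.
by rewrite addrA addNr add0r oppr_le0.
Qed.

Lemma Cm_closure_le k k' u : (k <= k')%N -> Cm_closure k' D u -> Cm_closure k D u.
Proof.
move=> kk [cu Cu]; split=> // s sk; have [d g] := Cu s (leq_trans sk kk).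
by split=> // i x sk'; apply: d; exact: leq_trans kk.
Qed.

Lemma lower_norm_bound (l1 C : R) : 0 <= l1 -> l1 < l -> 0 <= C ->
  exists2 C', 0 <= C' & forall u A h, 0 < h -> h <= h0 -> 0 <= A ->
    Cm_closure m D u -> hoelder_norm l D u = A%:E -> scaled_bound u A h C ->
    (hoelder_norm l1 D u <= (C' * (h `^ (l - l1) * A))%:E)%E.
Proof.
move=> l10 l1l C0; set n := Num.truncn l1.
have nm : (n <= m)%N by rewrite le_truncn// ltW.
have /andP[nl1 l1n] := truncn_itv l10; rewrite -/n in nl1 l1n.
have /andP[ml lm] := truncn_itv l_ge0.
pose a := l1 - n%:R.
have a0 : 0 <= a by rewrite subr_ge0.
have a1 : a <= 1 by rewrite lerBlDr addrC natr1 ltW.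
(* One summand for each case below: distant points, close points with [n < m], close points with
   [n = m]. *)
pose H := 2 * C / c + N%:R * C * (2 / c) + N%:R.
have Cc0 : 0 <= 2 * C / c by rewrite divr_ge0 ?mulr_ge0// ltW.
have NCc0 : 0 <= N%:R * C * (2 / c) by rewrite !mulr_ge0// invr_ge0 ltW.
have H_ge0 : 0 <= H by rewrite !addr_ge0.
exists (#|{ffun 'I_N -> 'I_n.+1}|%:R * (C + H));
  first by rewrite mulr_ge0// addr_ge0.
move=> u A h h_gt0 hh0 A0 Cu AE bd.
have h1 : h <= 1 by exact: le_trans h0_le1.
have Cu1 : Cm_closure n D u by exact: Cm_closure_le Cu.
have Cu' := Cm_closure_on oD Cu.
pose W := h `^ (l - l1) * A.
have W0 : 0 <= W by rewrite mulr_ge0 ?powR_ge0.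
have nz (b d : R) : (b + d == 0) ==> (h != 0) by rewrite (gt_eqF h_gt0) implybT.
have bdW s x : (size s <= n)%N -> D x -> `|partials s u x| <= C * W.
  move=> sn Dx; apply: le_trans (bd s x (leq_trans sn nm) Dx) _.
  rewrite ler_wpM2l// ler_wpM2r// ger_powR ?h_gt0// lerD2l lerN2.
  by rewrite (le_trans _ nl1)// ler_nat.
apply: le_trans (hoelder_norm_le (K := C * W) (H := H * W) l10 Cu1 _ _ bdW _) _.
- by rewrite mulr_ge0.
- by rewrite mulr_ge0.
- move=> s x y _ sn Dx Dy xy; rewrite -/n -/a.
  set t := `|x - y|.
  have t0 : 0 < t by rewrite normr_gt0 subr_eq0.
  have ta0 : 0 <= t `^ a by exact: powR_ge0.
  have Wt0 : 0 <= W * t `^ a by rewrite mulr_ge0.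
  have tsplit (b : R) : t `^ b = t `^ a * t `^ (b - a).
    by rewrite -powRD ?(gt_eqF t0) ?implybT// addrC subrK.
  rewrite -mulrA 2!mulrDl.
  have [far|near] := leP (c * h) t.
    apply: ler_wpDr; first by rewrite mulr_ge0.
    apply: ler_wpDr; first by rewrite mulr_ge0.
    have bds z : D z -> `|partials s u z| <= C * (h `^ (l - n%:R) * A).
      by move=> Dz; have := bd s z; rewrite sn; exact.
    apply: (@le_trans _ _ (2 * (C * (h `^ (l - n%:R) * A)))).
      by rewrite mulr_natl mulr2n (le_trans (ler_normB _ _))// lerD// bds.
    have ht : h `^ a <= c^-1 * t `^ a.
      have : (c * h) `^ a <= t `^ a.
        by rewrite ge0_ler_powR ?nnegrE ?mulr_ge0 ?(ltW t0) ?(ltW c0) ?(ltW h_gt0).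
      rewrite powRM ?(ltW c0) ?(ltW h_gt0)// => le_ch.
      rewrite ler_pdivlMl// (le_trans _ le_ch)// ler_wpM2r ?powR_ge0//.
      by rewrite ger1_powR// c0.
    have -> : h `^ (l - n%:R) = h `^ (l - l1) * h `^ a.
      by rewrite -powRD//; congr (_ `^ _); rewrite /a addrA subrK.
    rewrite (_ : 2 * C / c * (W * t `^ a) = 2 * C * W * (c^-1 * t `^ a));
      last by ring.
    rewrite (_ : 2 * (C * _) = 2 * C * W * h `^ a); last by rewrite /W; ring.
    by apply: ler_wpM2l => //; apply: mulr_ge0 => //; apply: mulr_ge0.
  have th : t < h.
    by rewrite (lt_le_trans near)// ler_piMl// ltW.
  have [nm'|mn] := ltnP n m.
    apply: ler_wpDr; first by rewrite mulr_ge0.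
    apply: ler_wpDl; first by rewrite mulr_ge0.
    (* The smallest scale at which [cone_condition] gives a point visible from both [x] and [y]; the
       path through it has length at most [2 * h']. *)
    pose h' := t / c.
    have h'0 : 0 < h' by rewrite divr_gt0.
    have h'h : h' <= h by rewrite ler_pdivrMr// mulrC ltW.
    have [|z zP] := coneD Dx Dy h'0 (le_trans h'h hh0).
      by rewrite /h' mulrCA divff ?gt_eqF// mulr1.
    have zz : `|z - z| < c * h' by rewrite subrr normr0 mulr_gt0.
    have [zx zy xzD yzD] := zP z zz.
    pose K := C * (h `^ (l - n.+1%:R) * A).
    have leK i w : D w -> `|partials (i :: s) u w| <= K.
      by move=> Dw; have := bd (i :: s) w; rewrite /= sn; apply.
    have K0 : 0 <= K by rewrite !mulr_ge0// powR_ge0.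
    have snm : (size s < m)%N by rewrite sn.
    have Lx := partial_lipschitz Cu' snm leK xzD.
    have Ly := partial_lipschitz Cu' snm leK yzD.
    have NK0 : 0 <= N%:R * K by rewrite mulr_ge0.
    apply: (@le_trans _ _ (N%:R * K * (2 * h'))).
      have -> : partials s u x - partials s u y =
        (partials s u z - partials s u y) - (partials s u z - partials s u x) by
          ring.
      rewrite (le_trans (ler_normB _ _))//.
      rewrite (_ : N%:R * K * (2 * h') = N%:R * K * h' + N%:R * K * h');
        last by ring.
      by apply: lerD; [apply: le_trans Ly _|apply: le_trans Lx _]; apply: ler_wpM2l.
    have ht : t <= t `^ a * h `^ (1 - a).
      rewrite -{1}[t]powRr1 ?(ltW t0)// (tsplit 1) ler_wpM2l//.
      by rewrite ge0_ler_powR ?nnegrE ?subr_ge0 ?(ltW t0) ?(ltW h_gt0)// ltW.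
    have -> : W = h `^ (l - n.+1%:R) * A * h `^ (1 - a).
      rewrite /W mulrAC -powRD//; congr (_ `^ _ * _).
      by rewrite /a -natr1; ring.
    rewrite /K /h' (_ : N%:R * _ * (2 * (t / c)) =
      N%:R * C * (2 / c) * (h `^ (l - n.+1%:R) * A) * t); last by ring.
    rewrite [leRHS](_ : _ = N%:R * C * (2 / c) * (h `^ (l - n.+1%:R) * A) *
      (t `^ a * h `^ (1 - a))); last by ring.
    by rewrite ler_wpM2l// mulr_ge0// mulr_ge0// powR_ge0.
  (* The top-order Hoelder condition applies directly, and [t < h] turns its surplus exponent
     [l - l1] into a power of [h]. *)
  have nE : n = m by apply/eqP; rewrite eqn_leq nm.
  apply: ler_wpDl; first by rewrite addr_ge0// mulr_ge0.
  have sm : size s = m by rewrite sn.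
  apply: le_trans (top_hoelder A0 Cu AE sm Dx Dy) _; rewrite -/t.
  rewrite (tsplit (l - m%:R)) -mulrA ler_wpM2l//.
  rewrite /W (_ : h `^ _ * A * _ = A * (t `^ a * h `^ (l - l1))); last by ring.
  rewrite ler_wpM2l// ler_wpM2l//.
  have -> : l - m%:R - a = l - l1 by rewrite /a nE; ring.
  by rewrite ge0_ler_powR ?nnegrE ?(ltW t0) ?(ltW h_gt0) ?subr_ge0// ltW.
by rewrite -mulrDl mulrA.
Qed.

End Interpolation.

(** * Choice of the scale *)

(** Any positive [V >= U] is allowed in place of [U], so that the scale remains positive when
    [U = 0]. *)
Lemma interpolation_le (R : realType) (N : nat) (D : set 'rV[R]_N) (l1 l2 p : R) :
  (0 < N)%N -> 1 < p -> 0 < l1 -> l1 < l2 -> l2 \isn't a Num.int -> open D ->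
  (exists h0 c : R, [/\ 0 < h0, 0 < c, c <= 1 & cone_condition D h0 c]) ->
  let w := (p * l1 + N%:R) / (p * l2 + N%:R) in
  exists2 C : R, 0 <= C & forall u A U V, hoelder_space l2 D u -> Lp_space p D u ->
    hoelder_norm l2 D u = A%:E -> Lp_norm p D u = U%:E -> 0 <= A -> 0 <= U ->
    U <= V -> 0 < V ->
    (hoelder_norm l1 D u <= (C * A `^ w * V `^ (1 - w))%:E)%E.
Proof.
move=> N0 p1 l10 l12 lint oD [h1 [c [h1_gt0 c0 c1 cone]]] w.
pose h0 := Num.min 1 h1.
have h0_gt0 : 0 < h0 by rewrite lt_min ltr01.
have h0_le1 : h0 <= 1 by rewrite ge_min lexx.
have l20 : 0 <= l2 by rewrite ltW// (lt_trans l10).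
have cone' : cone_condition D h0 c.
  by move=> x y h Dx Dy hp hh; apply: cone => //;
    rewrite (le_trans hh)// ge_min lexx orbT.
have [C C0 HC] := derivative_bound oD l20 lint p1 c0 c1 cone'.
pose C1 := C + h0 `^ (- l2).
have C10 : 0 <= C1 by rewrite addr_ge0// powR_ge0.
have [C2 C20 HC2] := lower_norm_bound oD l20 lint h0_le1 c0 c1 cone' (ltW l10)
  l12 C10.
have p0 : 0 < p by rewrite (lt_trans _ p1).
pose q := l2 + N%:R / p.
have q0 : 0 < q by rewrite ltr_pwDl ?divr_ge0 ?(ltW p0)// (lt_trans l10).
have plN l : 0 <= l -> 0 < p * l + N%:R.
  by move=> l_ge0; rewrite ltr_wpDl ?mulr_ge0 ?(ltW p0)// ltr0n.
have wE : 1 - w = (l2 - l1) / q.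
  have -> : q = (p * l2 + N%:R) / p by rewrite /q; field; rewrite gt_eqF.
  by rewrite /w; field; rewrite !gt_eqF ?plN.
exists C2 => // u A U V [Cu _] uLp AE UE A_ge0 U0 UV V0.
have [A0|An0] := eqVneq A 0.
  have bd s x : (size s <= Num.truncn l2)%N -> D x -> `|partials s u x| <=
      C1 * (h0 `^ (l2 - (size s)%:R) * A).
    move=> sm Dx.
    apply: le_trans (trivial_bound oD h0_gt0 h0_le1 N0 A_ge0 Cu AE sm Dx) _.
    by rewrite A0 !mulr0.
  apply: le_trans (HC2 u A h0 h0_gt0 (lexx _) A_ge0 Cu AE bd) _.
  by rewrite A0 !mulr0 lee_fin !mulr_ge0// powR_ge0.
have {An0 A_ge0}A0 : 0 < A by rewrite lt_neqAle eq_sym An0.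
(* The scale with [hs ^ q * A = V], at which the hypothesis of [derivative_bound] holds because
   [U <= V]. *)
pose hs := (V / A) `^ q^-1.
have VA0 : 0 < V / A by rewrite divr_gt0.
have hs0 : 0 < hs by rewrite powR_gt0.
pose h := Num.min h0 hs.
have h_gt0 : 0 < h by rewrite lt_min h0_gt0.
have hh0 : h <= h0 by rewrite ge_min lexx.
have bd : scaled_bound D l2 u A h C1.
  move=> s x sm Dx; have W0 : 0 <= h `^ (l2 - (size s)%:R) * A.
    by rewrite mulr_ge0 ?powR_ge0// ltW.
  have [hle|hlt] := leP h0 hs.
    have hE : h = h0 by rewrite /h min_l.
    rewrite hE in W0 *.
    apply: le_trans (trivial_bound oD h0_gt0 h0_le1 N0 (ltW A0) Cu AE sm Dx) _.
    by rewrite ler_wpM2r// lerDr.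
  have hE : h = hs by rewrite /h min_r// ltW.
  apply: (@le_trans _ _ (C * (h `^ (l2 - (size s)%:R) * A))).
    apply: (HC u A U) => //.
    rewrite hE -/q /hs -powRrM mulVf ?gt_eqF// powRr1 ?(ltW VA0)//.
    by rewrite divfK ?gt_eqF.
  by rewrite ler_wpM2r// lerDl powR_ge0.
apply: le_trans (HC2 u A h h_gt0 hh0 (ltW A0) Cu AE bd) _.
rewrite lee_fin -mulrA ler_wpM2l//.
apply: (@le_trans _ _ (hs `^ (l2 - l1) * A)).
  rewrite ler_wpM2r ?(ltW A0)// ge0_ler_powR ?nnegrE ?subr_ge0 ?(ltW l12)//.
  - exact: ltW.
  - exact: ltW.
  - by rewrite ge_min lexx orbT.
rewrite /hs -powRrM [q^-1 * _]mulrC -wE powRM ?(ltW V0) ?invr_ge0 ?(ltW A0)//.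
rewrite -[A^-1]powR_inv1 ?(ltW A0)// -powRrM mulN1r opprB.
rewrite (@powRB _ A w 1); last by rewrite (gt_eqF A0) implybT.
by rewrite powRr1 ?(ltW A0)// -mulrA divfK ?gt_eqF// mulrC.
Qed.

Theorem theorem3 (R : realType) (N : nat) (p l1 l2 : R) (Omega : set 'rV[R]_N) :
  (1 <= N)%N -> 1 < p -> 0 < l1 -> l1 < l2 -> l2 \isn't a Num.int ->
  is_domain Omega -> smooth_boundary l2 Omega ->
  let omega := (p * l1 + N%:R) / (p * l2 + N%:R) in
  exists C : R, 0 < C /\
    forall u : 'rV[R]_N -> R,
      hoelder_space l2 Omega u -> Lp_space p Omega u ->
      (hoelder_norm l1 Omega u <=
       C%:E * hoelder_norm l2 Omega u `^ omega
            * Lp_norm p Omega u `^ (1 - omega))%E.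
Proof.
case: N Omega => // n Omega N1 p1 l10 l12 lint [oD _ D0] smooth omega.
have cone := interior_cone oD smooth.
have [C C0 HC] := interpolation_le N1 p1 l10 l12 lint oD cone.
have p0 : 0 < p by rewrite (lt_trans _ p1).
have l20 : 0 < l2 by rewrite (lt_trans l10).
have den0 : 0 < p * l2 + n.+1%:R by rewrite addr_gt0// mulr_gt0.
have w0 : 0 < omega by rewrite divr_gt0// addr_gt0// mulr_gt0.
have w1 : 0 < 1 - omega.
  by rewrite subr_gt0 /omega ltr_pdivrMr// mul1r ltrD2r ltr_pM2l.
exists (C + 1); split; first by rewrite ltr_wpDl.
move=> u uH uLp; have [Cu ufin] := uH.
have [x Dx] := D0.
(* Distinct points show that the norm is nonnegative, hence, being less than [+oo], a real
   number. *)
have [a [b [Da Db ab]]] := open_two_points oD N1 Dx.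
have hn0 : (0 <= hoelder_norm l2 Omega u)%E.
  apply: le_trans (Cm_norm_le_hoelder l2 u Da Db ab).
  exact: Cm_norm_ge0 Dx.
have AE : hoelder_norm l2 Omega u = (fine (hoelder_norm l2 Omega u))%:E.
  by rewrite fineK// ge0_fin_numE.
have UE : Lp_norm p Omega u = (fine (Lp_norm p Omega u))%:E.
  by rewrite fineK// ge0_fin_numE ?Lnorm_ge0//; case: uLp.
move: (fine (hoelder_norm l2 Omega u)) AE => A AE.
move: (fine (Lp_norm p Omega u)) UE => U UE.
have U0 : 0 <= U by rewrite -lee_fin -UE Lnorm_ge0.
have A_ge0 : 0 <= A by rewrite -lee_fin -AE.
rewrite AE UE !poweR_EFin -!EFinM.
have {}HC V := HC u A U V uH uLp AE UE A_ge0 U0.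
have [U00|Un0] := eqVneq U 0; last first.
  apply: le_trans (HC U _ _) _ => //; first by rewrite lt_neqAle eq_sym Un0.
  by rewrite lee_fin -!mulrA ler_wpM2r ?lerDl// mulr_ge0 ?powR_ge0.
(* For [U = 0] the right-hand side vanishes because [1 - omega > 0]. The left-hand side is shown to
   be at most every [e > 0], using a [V] with [V ^ (1 - omega) = e / K]. *)
rewrite U00 (powR0 (lt0r_neq0 w1)) mulr0.
apply/lee_addgt0Pr => e e0; rewrite add0e.
pose K := C * A `^ omega + 1.
have K0 : 0 < K by rewrite ltr_wpDl// mulr_ge0// powR_ge0.
have V0 : 0 < (e / K) `^ (1 - omega)^-1 by rewrite powR_gt0// divr_gt0.
apply: le_trans (HC _ _ V0) _; first by rewrite U00 ltW.
rewrite lee_fin -powRrM mulVf ?gt_eqF// powRr1 ?divr_ge0 ?(ltW e0) ?(ltW K0)//.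
by rewrite mulrA ler_pdivrMr// mulrC ler_wpM2l ?(ltW e0)// lerDl.
Qed.
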